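(* Let $k \leq n$ be positive integers, let $\alpha_1, \dots, \alpha_k \in \mathbb{C}$ be distinct complex numbers, and let $$Z_{n,k} := \{ (\alpha_{w(1)}, \dots, \alpha_{w(n)}) : [w(1), \dots, w(n)] \in \mathcal{W}_{n,k} \} \subseteq \mathbb{C}^n.$$ Then $\mathrm{gr}\, \mathbf{I}(Z_{n,k}) = I_{n,k}$, so that $R_{n,k} = \mathbb{C}[x_1, \dots, x_n]/\mathrm{gr}\, \mathbf{I}(Z_{n,k})$ and $R_{n,k} \cong \mathbb{C}[\mathcal{W}_{n,k}]$ as ungraded $S_n$-modules. Furthermore, the set $$\{ \kappa_{\mathrm{rev}(\gamma(S))}(x_1, \dots, x_n) : S \subseteq [n], \ |S| = n-k+1 \} \cup \{ x_1^k, x_2^k, \dots, x_n^k \}$$ is a Gröbner basis of $I_{n,k}$ with respect to the neglex term order. The set $\mathcal{A}_{n,k}$ of $(n,k)$-substaircase monomials is the standard monomial basis of $R_{n,k}$ with respect to the neglex term order.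
   Context: Write $[n] = \{1, \dots, n\}$, and let $e_d = e_d(x_1, \dots, x_n)$ be the elementary symmetric polynomial of degree $d$. **Ring.** $I_{n,k} := \langle e_n, e_{n-1}, \dots, e_{n-k+1}, x_1^k, x_2^k, \dots, x_n^k \rangle \subseteq \mathbb{C}[x_1, \dots, x_n]$ and $R_{n,k} := \mathbb{C}[x_1, \dots, x_n]/I_{n,k}$. The symmetric group $S_n$ acts on $\mathbb{C}[x_1, \dots, x_n]$ by permuting variables, $v \cdot x_i = x_{v(i)}$; this preserves $I_{n,k}$ and so $S_n$ acts on $R_{n,k}$. **Fubini words.** $\mathcal{W}_{n,k}$ is the set of words $w = [w(1), \dots, w(n)]$ with letters in $\{1, \dots, k\}$ in which each of the letters $1, \dots, k$ appears at least once. $S_n$ acts on $\mathcal{W}_{n,k}$ by $v \cdot [w(1), \dots, w(n)] = [w(v^{-1}(1)), \dots, w(v^{-1}(n))]$, and $\mathbb{C}[\mathcal{W}_{n,k}]$ is the corresponding permutation module. **Associated graded ideal.** For a finite set $Z \subseteq \mathbb{C}^n$, $\mathbf{I}(Z) := \{ f \in \mathbb{C}[x_1, \dots, x_n] : f(\mathbf{z}) = 0 \text{ for all } \mathbf{z} \in Z \}$. For a nonzero polynomial $f = f_d + \cdots + f_1 + f_0$ with $f_i$ homogeneous of degree $i$ and $f_d \neq 0$, put $\tau(f) := f_d$. For an ideal $I$, $\mathrm{gr}\, I := \langle \tau(f) : f \in I \setminus \{0\} \rangle$. **Substaircase monomials.** An $(n,k)$-staircase is a shuffle (an interleaving preserving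 the relative order of each sequence) of the sequence $(k-1, k-2, \dots, 1, 0)$ with the sequence $(k-1, \dots, k-1)$ having $n-k$ entries. $E_{n,k}$ is the set of sequences $(a_1, \dots, a_n)$ of nonnegative integers which are componentwise $\leq$ at least one $(n,k)$-staircase, and $\mathcal{A}_{n,k} := \{ x_1^{a_1} \cdots x_n^{a_n} : (a_1, \dots, a_n) \in E_{n,k} \}$. **Term order and Gröbner notions.** The neglex term order is the lexicographic order with $x_n > \cdots > x_2 > x_1$: $x_1^{a_1} \cdots x_n^{a_n} < x_1^{b_1} \cdots x_n^{b_n}$ if there is $1 \leq i \leq n$ with $a_i < b_i$ and $a_{i+1} = b_{i+1}, \dots, a_n = b_n$. The initial term $\mathrm{in}_<(f)$ is the largest monomial appearing in $f$, and $\mathrm{in}_<(I) = \langle \mathrm{in}_<(f) : 0 \neq f \in I \rangle$. A finite set $G \subseteq I$ of nonzero polynomials is a Gröbner basis of $I$ if $\mathrm{in}_<(I) = \langle \mathrm{in}_<(g) : g \in G \rangle$. The standard monomial basis of $\mathbb{C}[x_1, \dots, x_n]/I$ is the set of monomials not contained in $\mathrm{in}_<(I)$. **Skip sequences.** For $S = \{s_1 < s_2 < \cdots < s_r\} \subseteq [n]$, the skip sequence $\gamma(S) = (\gamma(S)_1, \dots, \gamma(S)_n)$ is defined by $\gamma(S)_i = i - j + 1$ if $i = s_j \in S$, and $\gamma(S)_i = 0$ if $i \notin S$. For a sequence $\gamma = (\gamma_1, \dots, \gamma_n)$, $\mathrm{rev}(\gamma) = (\gamma_n, \dots, \gamma_1)$.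 **Demazure characters.** For a sequence $\gamma = (\gamma_1, \dots, \gamma_n)$ of nonnegative integers, $\kappa_\gamma$ is defined recursively: $\kappa_\gamma = x_1^{\gamma_1} \cdots x_n^{\gamma_n}$ if $\gamma_1 \geq \cdots \geq \gamma_n$, and $\kappa_\gamma = \pi_i(\kappa_{s_i \cdot \gamma})$ if $\gamma_i < \gamma_{i+1}$, where $s_i \cdot \gamma$ swaps the $i$-th and $(i+1)$-st entries of $\gamma$, and $\pi_i(f) := \dfrac{x_i f - x_{i+1}(s_i \cdot f)}{x_i - x_{i+1}}$, with $s_i \cdot f$ obtained from $f$ by swapping $x_i$ and $x_{i+1}$. (This is independent of choices.) *)

(* Defs.v *)
From HB Require Import structures.
From mathcomp Require Import all_boot all_order all_algebra all_fingroup.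
From mathcomp Require Import zify.
From mathcomp Require Import boolp classical_sets cardinality reals.
From mathcomp Require Import complex mpoly generic_quotient ring_quotient.

Set Implicit Arguments.
Unset Strict Implicit.
Unset Printing Implicit Defensive.

Import GRing.Theory.

Local Open Scope ring_scope.
Local Open Scope quotient_scope.
Local Open Scope classical_set_scope.

(* Ideals of a commutative ring; unlike [idealr], not required to be proper
   nor decidable. *)
Section Ideals.
Variable A : comNzRingType.

Record ideal := Ideal {
  ideal_set :> set A;
  ideal0 : ideal_set 0;
  idealD : forall a b, ideal_set a -> ideal_set b -> ideal_set (a + b);
  idealM : forall a b, ideal_set b -> ideal_set (a * b) }.

Lemma ideal_ext (I J : ideal) : (I : set A) = J -> I = J.
Proof.
case: I J => [I I0 ID IM] [J J0 JD JM] /= eIJ; case: J / eIJ J0 JD JM => *.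
by congr Ideal; apply: Prop_irrelevance.
Qed.

Section Generated.
Variable G : set A.

Definition gen_set : set A := [set f | exists2 s : seq (A * A),
  forall u, u \in s -> G u.2 & f = \sum_(u <- s) u.1 * u.2].

Lemma gen_set0 : gen_set 0.
Proof. by exists [::]; rewrite ?big_nil. Qed.

Lemma gen_setD a b : gen_set a -> gen_set b -> gen_set (a + b).
Proof.
move=> [s sG ->] [t tG ->]; exists (s ++ t); last by rewrite big_cat.
by move=> u; rewrite mem_cat => /orP[/sG|/tG].
Qed.

Lemma gen_setM a b : gen_set b -> gen_set (a * b).
Proof.
move=> [s sG ->]; exists [seq (a * u.1, u.2) | u <- s].
  by move=> _ /mapP[u /sG ? ->].
by rewrite big_map mulr_sumr; apply: eq_bigr => u _; rewrite mulrA.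
Qed.

Definition ideal_gen := Ideal gen_set0 gen_setD gen_setM.

Lemma ideal_gen_min (I : ideal) : G `<=` I -> ideal_gen `<=` I.
Proof.
move=> GI _ [s sG ->]; elim: s sG => [|u s IHs] sG.
  by rewrite big_nil; apply: ideal0.
rewrite big_cons; apply: idealD.
  by apply/idealM/GI/sG; rewrite mem_head.
by apply: IHs => v vs; apply: sG; rewrite inE vs orbT.
Qed.

Lemma ideal_gen_sub : G `<=` ideal_gen.
Proof.
move=> a Ga; exists [:: (1, a)]; last by rewrite big_seq1 mul1r.
by move=> u; rewrite inE => /eqP ->.
Qed.

End Generated.

Definition ideal_pred (I : ideal) : {pred A} := fun a => `[< ideal_set I a >].

Lemma ideal_predE (I : ideal) a : (a \in ideal_pred I) = `[< ideal_set I a >].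
Proof. by []. Qed.

Lemma ideal_pred_zmod_closed (I : ideal) : zmod_closed (ideal_pred I).
Proof.
split=> [|a b]; rewrite !ideal_predE; first exact/asboolP/ideal0.
move=> /asboolP Ia /asboolP Ib; apply/asboolP/idealD => //.
by rewrite -mulN1r; apply: idealM.
Qed.

HB.instance Definition _ (I : ideal) :=
  GRing.isZmodClosed.Build A (ideal_pred I) (ideal_pred_zmod_closed I).

Definition ideal_quo (I : ideal) := {ideal_quot (ideal_pred I)}.

End Ideals.

(* [ring_quotient] only puts a ring structure on quotients by proper ideals. *)
Section QuotientRing.
Variables (A : comNzRingType) (I : ideal A).

Local Notation Q := (ideal_quo I).

HB.instance Definition _ := GRing.Zmodule.on Q.
HB.instance Definition _ :=
  EqQuotient.copy Q {ideal_quot (ideal_pred I)}.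

Definition quo_pi (a : A) : Q := \pi_Q a.

Lemma quo_piP a b : quo_pi a = quo_pi b <-> ideal_set I (a - b).
Proof.
rewrite -[ideal_set I _]asboolE -ideal_predE Quotient.idealrBE.
by split=> [/eqP|/eqP].
Qed.

Lemma quo_piK (x : Q) : quo_pi (repr x) = x.
Proof. exact: reprK. Qed.

Lemma quo_pi_zmod_morphism : zmod_morphism quo_pi.
Proof. by move=> a b; rewrite /quo_pi !piE. Qed.

HB.instance Definition _ :=
  GRing.isZmodMorphism.Build A Q quo_pi quo_pi_zmod_morphism.

Definition quo_mul (x y : Q) : Q := quo_pi (repr x * repr y).

Lemma quo_pi_mul a b : quo_mul (quo_pi a) (quo_pi b) = quo_pi (a * b).
Proof.
apply/quo_piP; set a' := repr _; set b' := repr _.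
have Ia : ideal_set I (a' - a) by apply/quo_piP; rewrite quo_piK.
have Ib : ideal_set I (b' - b) by apply/quo_piP; rewrite quo_piK.
have -> : a' * b' - a * b = b' * (a' - a) + a * (b' - b).
  by rewrite !mulrBr (mulrC b' a') (mulrC b' a) addrA subrK.
by apply: idealD; apply: idealM.
Qed.

Lemma quo_mulA : associative quo_mul.
Proof.
by move=> x y z; rewrite -[x]quo_piK -[y]quo_piK -[z]quo_piK !quo_pi_mul mulrA.
Qed.

Lemma quo_mulC : commutative quo_mul.
Proof. by move=> x y; rewrite -[x]quo_piK -[y]quo_piK !quo_pi_mul mulrC. Qed.

Lemma quo_mul1 : left_id (quo_pi 1) quo_mul.
Proof. by move=> x; rewrite -[x]quo_piK quo_pi_mul mul1r. Qed.

Lemma quo_mulDl : left_distributive quo_mul +%R.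
Proof.
move=> x y z; rewrite -[x]quo_piK -[y]quo_piK -[z]quo_piK.
by rewrite -raddfD !quo_pi_mul mulrDl raddfD.
Qed.

HB.instance Definition _ := GRing.Zmodule_isComPzRing.Build Q
  quo_mulA quo_mulC quo_mul1 quo_mulDl.

Lemma quo_pi_monoid_morphism : monoid_morphism quo_pi.
Proof. by split=> // a b; rewrite -quo_pi_mul. Qed.

HB.instance Definition _ :=
  GRing.isMonoidMorphism.Build A Q quo_pi quo_pi_monoid_morphism.

End QuotientRing.

Section QuotientModule.
Variables (K : nzRingType) (A : comAlgType K) (I : ideal A).

Local Notation Q := (ideal_quo I).

Definition quo_scale (c : K) (x : Q) : Q := quo_pi I (c%:A) * x.

Lemma quo_pi_scale c a : quo_scale c (quo_pi I a) = quo_pi I (c *: a).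
Proof. by rewrite /quo_scale -rmorphM /= mulr_algl. Qed.

Lemma quo_scaleA c d x : quo_scale c (quo_scale d x) = quo_scale (c * d) x.
Proof. by rewrite -[x]quo_piK !quo_pi_scale scalerA. Qed.

Lemma quo_scale1 : left_id 1 quo_scale.
Proof. by move=> x; rewrite -[x]quo_piK quo_pi_scale scale1r. Qed.

Lemma quo_scaleDr : right_distributive quo_scale +%R.
Proof. by move=> c x y; rewrite /quo_scale mulrDr. Qed.

Lemma quo_scaleDl x : {morph quo_scale^~ x : c d / c + d}.
Proof. by move=> c d; rewrite /quo_scale scalerDl raddfD mulrDl. Qed.

HB.instance Definition _ := GRing.Zmodule_isLmodule.Build K Q
  quo_scaleA quo_scale1 quo_scaleDr quo_scaleDl.

Lemma quo_piZ c a : quo_pi I (c *: a) = c *: quo_pi I a.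
Proof. by rewrite -quo_pi_scale. Qed.

HB.instance Definition _ :=
  GRing.isScalable.Build K A Q *:%R (quo_pi I) quo_piZ.

End QuotientModule.

(* All indices and letters are shifted to start from 0: [n] is ['I_n] and
   {1, ..., k} is ['I_k]. *)

Section Polynomials.
Variables (K : fieldType) (n : nat).

Local Notation P := {mpoly K[n]}.

Definition vanishing_set (Z : set ('I_n -> K)) : set P :=
  [set f | forall z, Z z -> f.@[z] = 0].

Lemma vanishing0 Z : vanishing_set Z 0.
Proof. by move=> z _; rewrite meval0. Qed.

Lemma vanishingD Z f g :
  vanishing_set Z f -> vanishing_set Z g -> vanishing_set Z (f + g).
Proof. by move=> Zf Zg z zZ; rewrite mevalD Zf // Zg // addr0. Qed.

Lemma vanishingM Z f g : vanishing_set Z g -> vanishing_set Z (f * g).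
Proof. by move=> Zg z zZ; rewrite mevalM Zg // mulr0. Qed.

Definition vanishing_ideal Z : ideal P :=
  @Ideal _ (vanishing_set Z) (@vanishing0 Z) (@vanishingD Z) (@vanishingM Z).

Definition top_form (f : P) : P := pihomog mdeg (msize f).-1 f.

Definition gr_ideal (I : ideal P) : ideal P :=
  ideal_gen [set top_form f | f in [set f | ideal_set I f /\ f != 0]].

(* Term orders are given by their strict part. *)
Definition neglex : rel 'X_{1..n} := fun a b =>
  [exists i : 'I_n, (a i < b i)%N && [forall j : 'I_n, (i < j)%N ==> (a j == b j)]].

Definition is_initial (lt : rel 'X_{1..n}) (f : P) (m : 'X_{1..n}) : Prop :=
  m \in msupp f /\ forall m', m' \in msupp f -> m' != m -> lt m' m.

Definition initial_terms lt (F : set P) : set P :=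
  [set t | exists f m, [/\ F f, f != 0, is_initial lt f m & t = 'X_[m]]].

Definition initial_ideal lt (I : ideal P) : ideal P :=
  ideal_gen (initial_terms lt I).

Definition groebner_basis lt (I : ideal P) (G : set P) : Prop :=
  [/\ finite_set G, G `<=` I, forall g, G g -> g != 0
    & initial_ideal lt I = ideal_gen (initial_terms lt G)].

Definition standard_monomials lt (I : ideal P) : set P :=
  [set t | exists2 m : 'X_{1..n}, t = 'X_[m] & ~ ideal_set (initial_ideal lt I) t].

Definition swap_exponents (i j : 'I_n) (g : 'X_{1..n}) : 'X_{1..n} :=
  [multinom g (tperm i j l) | l < n].

(* [demazure g p] says that p is a value of the Demazure character of g; the
   last premise of [demazure_step] says q = pi_i p, with the denominator
   cleared (which determines q, as {mpoly K[n]} is a domain). *)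
Inductive demazure : 'X_{1..n} -> P -> Prop :=
| demazure_dominant (g : 'X_{1..n}) of
    (forall i j : 'I_n, (i <= j)%N -> (g j <= g i)%N) :
    demazure g 'X_[g]
| demazure_step (g : 'X_{1..n}) (i j : 'I_n) (p q : P) of
    j = i.+1 :> nat & (g i < g j)%N & demazure (swap_exponents i j g) p &
    ('X_i - 'X_j) * q = 'X_i * p - 'X_j * msym (tperm i j) p :
    demazure g q.

Lemma pi_exists (i j : 'I_n) (p : P) :
  exists q, ('X_i - 'X_j) * q = 'X_i * p - 'X_j * msym (tperm i j) p.
Proof.
suff [g Eg] : exists g, p - msym (tperm i j) p = ('X_i - 'X_j) * g.
  exists (p + 'X_j * g); rewrite mulrDr mulrCA -Eg mulrBl mulrBr.
  by rewrite addrA subrK.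
pose D (f : P) := exists g, f - msym (tperm i j) f = ('X_i - 'X_j) * g.
have D1 : D 1 by exists 0; rewrite msym1 subrr mulr0.
have DM f g : D f -> D g -> D (f * g).
  move=> [f' Ef] [g' Eg]; exists (f * g' + f' * msym (tperm i j) g).
  by rewrite mulrDr mulrCA -Eg mulrA -Ef mulrBl mulrBr rmorphM addrA subrK.
have DX l : D 'X_l.
  rewrite /D msymX; have -> : [multinom U_(l)%MM ((tperm i j)^-1%g k) | k < n]
      = U_(tperm i j l)%MM.
    by apply/mnmP => k; rewrite !mnmE tpermV (canF_eq (tpermK i j)).
  case: tpermP => [->|->|_ _]; first by exists 1; rewrite mulr1.
    by exists (-1); rewrite mulrN1 opprB.
  by exists 0; rewrite subrr mulr0.
elim/mpolyind: p => [|c m f _ _ [g Eg]].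
  by exists 0; rewrite msym0 subr0 mulr0.
have [h Eh] : D 'X_[m].
  rewrite mpolyXE_id; apply: big_ind => // l _.
  by elim: (m l) => [|e IHe]; rewrite ?expr0 // exprS; apply: DM.
exists (c *: h + g); rewrite msymD msymZ opprD addrACA -scalerBr Eh Eg.
by rewrite mulrDr scalerAr.
Qed.

Lemma demazure_exists (g : 'X_{1..n}) : exists p, demazure g p.
Proof.
have [N] := ubnP (\sum_(l < n) l * g l)%N; elim: N g => // N IHN g ltN.
have [/existsP[i /existsP[j /andP[/eqP ij ltg]]]|noasc] :=
    boolP [exists i : 'I_n, exists j : 'I_n, (j == i.+1 :> nat) && (g i < g j)%N].
  have neq : i != j by rewrite -val_eqE /= ij neq_ltn ltnSn.
  have [|p dp] := IHN (swap_exponents i j g).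
    move: ltN; rewrite ltnS; apply: leq_trans; rewrite (bigD1 i) // [in X in (_ < X)%N](bigD1 i) //=.
    rewrite (bigD1 j) 1?eq_sym // [in X in (_ < X)%N](bigD1 j) 1?eq_sym //=.
    rewrite !addnA !mnmE tpermL tpermR ij.
    rewrite (eq_bigr (fun l : 'I_n => l * g l)%N) => [|l /andP[li lj]].
      by rewrite ltn_add2r !mulSn; nia.
    by rewrite mnmE tpermD // eq_sym.
  have [q Eq] := pi_exists i j p; exists q.
  exact: (demazure_step ij ltg dp Eq).
exists 'X_[g]; apply: demazure_dominant => i j.
have noasc1 (a b : 'I_n) : b = a.+1 :> nat -> (g b <= g a)%N.
  move=> ab; rewrite leqNgt; apply: contra noasc => lab.
  by apply/existsP; exists a; apply/existsP; exists b; rewrite ab eqxx.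
move: j; case=> j; elim: j => [|j IHj] ltj /= leij.
  by rewrite (_ : Ordinal ltj = i) //; apply/val_inj/esym/eqP; rewrite -leqn0.
move: leij; rewrite leq_eqVlt => /orP[/eqP Ei|].
  by rewrite (_ : Ordinal ltj = i) //; apply/val_inj.
rewrite ltnS => leij; apply: leq_trans (IHj (ltnW ltj) leij).
exact: noasc1.
Qed.

(* The 1-based position of i is i.+1, and its 1-based rank in S is
   #|[set t in S | t <= i]|. *)
Definition skip_seq (S : {set 'I_n}) : 'X_{1..n} :=
  [multinom if i \in S then (i.+1 - #|[set t in S | (t <= i)%N]%SET| + 1)%N
            else 0%N | i < n].

Definition rev_exponents (g : 'X_{1..n}) : 'X_{1..n} :=
  [multinom g (rev_ord i) | i < n].

Definition Ink_gens (k : nat) : set P :=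
  [set mesym n K d | d in [set d | (n - k < d <= n)%N]] `|`
  [set 'X_i ^+ k | i in [set: 'I_n]].

Definition Ink (k : nat) : ideal P := ideal_gen (Ink_gens k).

Definition Rnk (k : nat) := ideal_quo (Ink k).

Definition demazure_gens (k : nat) : set P :=
  [set p | exists2 S : {set 'I_n}, #|S| = (n - k + 1)%N
         & demazure (rev_exponents (skip_seq S)) p] `|`
  [set 'X_i ^+ k | i in [set: 'I_n]].

Definition shuffle (s t u : seq nat) : Prop :=
  exists m : bitseq,
    [/\ size m = size u, mask m u = s & mask (map negb m) u = t].

Definition staircase (k : nat) (u : seq nat) : Prop :=
  shuffle (rev (iota 0 k)) (nseq (n - k) k.-1) u.

Definition substaircase (k : nat) : set 'X_{1..n} :=
  [set a | exists2 u, staircase k u & forall i : 'I_n, (a i <= nth 0 u i)%N].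

Definition Ank (k : nat) : set P := [set 'X_[a] | a in substaircase k].

End Polynomials.

Section SymmetricGroupModules.
Variables (K : fieldType) (n k : nat).

Local Notation P := {mpoly K[n]}.

HB.instance Definition _ := GRing.ComPzRing.on (Rnk K n k).
HB.instance Definition _ := GRing.Lmodule.on (Rnk K n k).

(* [msym v 'X_i = 'X_(v i)] *)
Definition Rnk_act (v : 'S_n) (x : Rnk K n k) : Rnk K n k :=
  quo_pi (Ink K n k) (msym v (repr x)).

Lemma Ink_msym v (f : P) :
  ideal_set (Ink K n k) f -> ideal_set (Ink K n k) (msym v f).
Proof.
move=> [s sG ->]; rewrite big_seq rmorph_sum.
apply: (big_ind (ideal_set (Ink K n k))); first exact: ideal0.
  by move=> a b; apply: idealD.
move=> u us; rewrite rmorphM; apply: idealM; apply: ideal_gen_sub.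
have [[d dk <-]|[i _ <-]] := sG _ us.
  by left; exists d => //; rewrite [RHS](issymP _ (mesym_sym n K d) v).
right; exists (v i) => //; rewrite rmorphXn /= msymX; congr ('X_[_] ^+ _).
by apply/mnmP => l; rewrite !mnmE (canF_eq (permK v)).
Qed.

Lemma Rnk_act_pi v f :
  Rnk_act v (quo_pi (Ink K n k) f) = quo_pi (Ink K n k) (msym v f).
Proof.
apply/quo_piP; rewrite -raddfB; apply: Ink_msym.
by apply/quo_piP; rewrite quo_piK.
Qed.

Definition is_fubini (w : {ffun 'I_n -> 'I_k}) : bool :=
  [forall a, exists i, w i == a].

Definition fubini_word := {w : {ffun 'I_n -> 'I_k} | is_fubini w}.
HB.instance Definition _ := Finite.on fubini_word.

Lemma fubini_act_subproof (v : 'S_n) (w : fubini_word) :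
  is_fubini [ffun i => val w ((v^-1)%g i)].
Proof.
apply/forallP => a; have /existsP[i /eqP <-] := forallP (valP w) a.
by apply/existsP; exists (v i); rewrite ffunE permK.
Qed.

Definition fubini_act (v : 'S_n) (w : fubini_word) : fubini_word :=
  Sub _ (fubini_act_subproof v w).

Definition CWnk := {ffun fubini_word -> K^o}.
HB.instance Definition _ := GRing.Lmodule.on CWnk.

(* v . (\sum_w c_w w) = \sum_w c_w (v . w), so the coefficient of w is
   c_(v^-1 . w). *)
Definition CWnk_act (v : 'S_n) (x : CWnk) : CWnk :=
  [ffun w => x (fubini_act (v^-1)%g w)].

Definition Sn_isomorphic (V W : lmodType K) (actV : 'S_n -> V -> V)
    (actW : 'S_n -> W -> W) : Prop :=
  exists phi : {linear V -> W},
    bijective phi /\ forall v x, phi (actV v x) = actW v (phi x).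

Definition Znk (alpha : 'I_k -> K) : set ('I_n -> K) :=
  [set (fun i => alpha (val w i)) | w in [set: fubini_word]].

End SymmetricGroupModules.

Arguments neglex n : clear implicits.
Arguments demazure_gens K n k : clear implicits.
Arguments Ank K n k : clear implicits.
Arguments Rnk_act K n k : clear implicits.
Arguments CWnk_act K n k : clear implicits.
Arguments Znk [K] n [k] alpha.

(* Main.v *)
(** Write I for I_(n,k) and J for I(Z_(n,k)). Both families of generators of I
    are leading forms of elements of J: x_i^k of \prod_a (x_i - alpha_a), and e_d
    of a combination of e_0, .., e_d read off from the polynomial
    \prod_i (1 - x_i T) / \prod_a (1 - alpha_a T) on Z_(n,k). In the other
    direction, kappa_(rev gamma(S)) is a flagged Schur polynomial, hence a
    flagged Jacobi-Trudi determinant. Its neglex leading term comes from the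
    diagonal, and it lies in <e_(n-k+1), .., e_n> because these generators give a
    linear relation between the columns. So, modulo I, every polynomial reduces
    to a combination of monomials divisible neither by these leading terms nor by
    the x_i^k, without raising degree or neglex order. These are the
    substaircase monomials, recognized by a greedy algorithm; reading a Fubini
    word while tracking the number of unseen letters satisfies the same recursion,
    so there are as many of them as points of Z_(n,k). They span the functions on
    Z_(n,k), hence are linearly independent modulo J. This forces I = gr J and
    identifies the standard monomials.

    For the S_n-modules, reduce modulo I, evaluate on Z_(n,k) and average over
    S_n: the resulting equivariant map differs from evaluation by terms of lower
    degree, so it is surjective, and the dimensions agree. *)

From HB Require Import structures.
Require Import Defs.
From mathcomp Require Import all_boot all_order all_algebra all_fingroup.
From mathcomp Require Import zify ring.
From mathcomp Require Import boolp classical_sets cardinality reals.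
From mathcomp Require Import complex mpoly generic_quotient ring_quotient.

Set Implicit Arguments.
Unset Strict Implicit.
Unset Printing Implicit Defensive.

Import GRing.Theory.

Local Open Scope ring_scope.

(** * Complete homogeneous symmetric functions *)

Section CompleteHomogeneous.
Variable A : comNzRingType.
Implicit Types (s : seq A) (x y : A) (m d : nat).

Fixpoint hsym s m : A :=
  if s is x :: s' then \sum_(c < m.+1) x ^+ c * hsym s' (m - c)
  else (m == 0)%:R.

Lemma hsym0 s : hsym s 0 = 1.
Proof. by elim: s => //= x s IHs; rewrite big_ord1 expr0 mul1r IHs. Qed.

Lemma hsym_nil m : hsym [::] m = (m == 0)%:R. Proof. by []. Qed.

Lemma hsym_consE x s m :
  hsym (x :: s) m = \sum_(c < m.+1) x ^+ c * hsym s (m - c).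
Proof. by []. Qed.

Arguments hsym : simpl never.

Lemma hsymS x s m : hsym (x :: s) m.+1 = hsym s m.+1 + x * hsym (x :: s) m.
Proof.
rewrite !hsym_consE big_ord_recl expr0 mul1r subn0; congr (_ + _).
by rewrite mulr_sumr; apply: eq_bigr => c _; rewrite exprS mulrA.
Qed.

Lemma eq_hsym_cons x s t : hsym s =1 hsym t -> hsym (x :: s) =1 hsym (x :: t).
Proof. by move=> est m; rewrite !hsym_consE; apply: eq_bigr => c _; rewrite est. Qed.

(* The divided difference [\pi_i] sends h_m(.., x_i) to h_m(.., x_i, x_(i+1)). *)
Lemma hsym_swap_sub x y s m :
  (x - y) * hsym [:: x, y & s] m = x * hsym (x :: s) m - y * hsym (y :: s) m.
Proof.
elim: m => [|m IHm]; first by rewrite !hsym0 !mulr1.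
rewrite hsymS mulrDr mulrCA IHm (hsymS x s) (hsymS y s).
ring.
Qed.

(** In [hsym_swap_sub] the factor [x - y] may be a zero divisor and cannot be cancelled, hence the
    induction on the degree. *)
Lemma hsym_swap x y s : hsym [:: x, y & s] =1 hsym [:: y, x & s].
Proof.
elim=> [|m IHm]; first by rewrite !hsym0.
have := hsym_swap_sub x y s m; rewrite !(hsymS _ (_ :: _)) (hsymS x s) (hsymS y s).
rewrite IHm => e.
have -> : x * hsym [:: y, x & s] m
    = x * hsym (x :: s) m - y * hsym (y :: s) m + y * hsym [:: y, x & s] m.
  by rewrite -e; ring.
ring.
Qed.

Lemma hsym_rcons x s : hsym (rcons s x) =1 hsym (x :: s).
Proof.
elim: s => //= y s IHs m; rewrite hsym_swap.
exact: eq_hsym_cons.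
Qed.

Lemma hsym_rot i s : hsym (rot i s) =1 hsym s.
Proof.
elim: i => [|i IHi] m; first by rewrite rot0.
have [lts|ges] := ltnP i (size s); last by rewrite rot_oversize // ltnW.
rewrite (rotS lts) -IHi; case: (rot i s) => // x t.
by rewrite rot1_cons hsym_rcons.
Qed.

Lemma hsym_perm s t : perm_eq s t -> hsym s =1 hsym t.
Proof.
elim: s t => [|x s IHs] t.
  by rewrite perm_sym => /perm_nilP ->.
rewrite perm_sym => /perm_consP[i [u [et us]]] m.
rewrite -(hsym_rot i t) et; apply: eq_hsym_cons => l.
by apply: IHs; rewrite perm_sym.
Qed.

(* [hsym s (m - d)] with the convention that h_i = 0 for i < 0. *)
Definition hsub s m d := if (d <= m)%N then hsym s (m - d) else 0.

Lemma hsubSS s m d : hsub s m.+1 d.+1 = hsub s m d.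
Proof. by []. Qed.

Lemma hsub_cons x s m d :
  hsub (x :: s) m d = hsub s m d + x * hsub (x :: s) m d.+1.
Proof.
rewrite /hsub; have [ltdm|ltmd|<-] := ltngtP d m.
- by rewrite -(subnSK ltdm) hsymS.
- by rewrite mulr0 addr0.
- by rewrite mulr0 addr0 subnn !hsym0.
Qed.

Lemma hsub_perm s t : perm_eq s t -> hsub s =2 hsub t.
Proof. by move=> st m d; rewrite /hsub (hsym_perm st). Qed.

Lemma hsub_swap_sub x y s m d :
  (x - y) * hsub [:: x, y & s] m d
    = x * hsub (x :: s) m d - y * hsub (y :: s) m d.
Proof. by rewrite /hsub; case: leqP => _; rewrite ?hsym_swap_sub // !mulr0 subr0. Qed.

(* h(s) has generating function 1 / \prod_(x <- s) (1 - x Z). *)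
Lemma coef_conv_hsym s (q : {poly A}) m :
  \sum_(l < m.+1) (q * \prod_(x <- s) (1 - x *: 'X))`_l * hsym s (m - l) = q`_m.
Proof.
elim: s q m => [|x s IHs] q m.
  rewrite big_nil mulr1 big_ord_recr /= subnn hsym0 mulr1 big1 ?add0r // => l _.
  by rewrite hsym_nil subn_eq0 leqNgt ltn_ord mulr0.
rewrite big_cons mulrCA; set p := q * _.
have coefSE l : ((1 - x *: 'X) * p)`_l.+1 = p`_l.+1 - x * p`_l.
  by rewrite mulrBl mul1r -scalerAl coefB coefZ coefXM.
have coef0E : ((1 - x *: 'X) * p)`_0 = p`_0.
  by rewrite mulrBl mul1r -scalerAl coefB coefZ coefXM mulr0 subr0.
rewrite -(IHs q m) -/p; case: m => [|m].
  by rewrite !big_ord1 coef0E !hsym0.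
rewrite big_ord_recl coef0E subn0.
under eq_bigr => l _ do rewrite coefSE mulrBl subSS.
rewrite sumrB; apply/eqP; rewrite addrA subr_eq; apply/eqP.
have -> : p`_0 * hsym (x :: s) m.+1
      + \sum_(l < m.+1) p`_(lift ord0 l) * hsym (x :: s) (m - l)
    = \sum_(l < m.+2) p`_l * hsym (x :: s) (m.+1 - l).
  by rewrite [RHS]big_ord_recl subn0.
rewrite [LHS]big_ord_recr [in RHS]big_ord_recr /= subnn.
rewrite !hsym0 addrAC; congr (_ + _).
rewrite -big_split /=; apply: eq_bigr => l _.
have le_lm : (l <= m)%N by rewrite -ltnS.
rewrite subSn // hsymS; ring.
Qed.

Lemma size_prod_1subZX (I : finType) (Q : pred I) (x : I -> A) :
  (size (\prod_(i | Q i) (1 - x i *: 'X) : {poly A})%R <= #|Q|.+1)%N.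
Proof.
rewrite -sum1_card; elim/big_rec2: _ => [|i e p _ szp]; first by rewrite size_poly1.
apply: leq_trans (size_polyMleq _ _) _.
have sz2 : (size (1 - x i *: 'X : {poly A})%R <= 2)%N.
  apply: leq_trans (size_polyD _ _) _; rewrite geq_max size_poly1 size_polyN.
  by apply: leq_trans (size_scale_leq _ _) _; rewrite size_polyX.
apply: leq_trans (_ : (2 + e.+1).-1 <= _)%N; last by lia.
by rewrite -!subn1 leq_sub2r // leq_add.
Qed.

(** The monomial case of the flagged Jacobi-Trudi determinant. Subtracting [x 0] times the preceding
    column from each later one removes [x 0] from the flags in those columns and clears the first
    row beyond its corner [x 0 ^+ mu 0]. The remaining minor has the same form for shifted [x] and
    [mu]. *)
Lemma det_hsub_flag r (x : nat -> A) (mu : nat -> nat) :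
  \det (\matrix_(i < r, j < r) hsub (mkseq x i.+1) (mu i + j) i)
    = \prod_(i < r) x i ^+ mu i.
Proof.
elim: r x mu => [|r IHr] x mu; first by rewrite det_mx00 big_ord0.
set M := \matrix_(i, j) _.
pose U : 'M[A]_r.+1 :=
  \matrix_(l, j) ((l == j)%:R - x 0%N * (l.+1 == j :> nat)%:R).
have detU : \det U = 1.
  rewrite -det_tr det_trig.
    apply: big1 => i _; rewrite !mxE eqxx.
    by rewrite gtn_eqF // mulr0 subr0.
  apply/is_trig_mxP => i j ltij; rewrite !mxE -val_eqE gtn_eqF //.
  by rewrite gtn_eqF ?mulr0 ?subr0 // ltnW.
have MU i j : (M *m U) i j = if unlift ord0 j is Some j' then
    hsub (mkseq (x \o S) i) (mu i + j) i else hsub (mkseq x i.+1) (mu i) i.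
  rewrite mxE; under eq_bigr => l _ do rewrite !mxE mulrBr.
  rewrite sumrB (bigD1 j) //= eqxx mulr1 big1 ?addr0; last first.
    by move=> l /negPf ->; rewrite mulr0.
  case: unliftP => [j' ->|->] /=; last first.
    by rewrite addn0 big1 ?subr0 // => l _; rewrite !mulr0.
  rewrite (bigD1 (widen_ord (leqnSn r) j')) //= eqxx mulr1 big1 ?addr0.
    rewrite [mkseq x i.+1](_ : _ = x 0%N :: mkseq (x \o S) i).
      rewrite [X in X - _]hsub_cons addnS hsubSS.
      by rewrite [X in _ - X]mulrC addrK.
    by rewrite /mkseq /= (iotaDl 1 0 i) -map_comp.
  by move=> l; rewrite -val_eqE /= eqSS => /negPf ->; rewrite !mulr0.
have -> : \det M = \det (M *m U) by rewrite det_mulmx detU mulr1.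
rewrite (expand_det_row _ ord0).
rewrite !big_ord_recl MU unlift_none big1 ?addr0; last first.
  by move=> j _; rewrite MU liftK /= /hsub /= addnS mul0r.
congr (_ * _).
  rewrite /hsub subn0 hsym_consE big_ord_recr /= subnn mulr1 big1 ?add0r // => c _.
  by rewrite hsym_nil subn_eq0 leqNgt ltn_ord mulr0.
rewrite /cofactor addn0 expr0 mul1r.
rewrite [RHS](_ : _ = \prod_(i < r) (x \o S) i ^+ (mu \o S) i) // -IHr.
congr (\det _); apply/matrixP => i j; rewrite 2![LHS]mxE MU liftK [RHS]mxE.
by rewrite !lift0 addnS hsubSS.
Qed.

End CompleteHomogeneous.

(** * The neglex order *)

Section SupportedIn.
Variables (K : fieldType) (n : nat).
Implicit Types (f g : {mpoly K[n]}) (a b m : 'X_{1..n}) (Q : pred 'X_{1..n}).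

Definition suppin Q f := {in msupp f, forall m, Q m}.

Lemma suppin_coef Q f : suppin Q f <-> forall m, ~~ Q m -> f@_m = 0.
Proof.
split=> [Qf m|f0 m]; first by apply: contraNeq; rewrite -mcoeff_msupp => /Qf.
by rewrite mcoeff_msupp; apply: contraNT => /f0 ->.
Qed.

Lemma suppinW Q1 Q2 f : {subset Q1 <= Q2} -> suppin Q1 f -> suppin Q2 f.
Proof. by move=> s12 Qf m /Qf /s12. Qed.

Lemma suppin0 Q : suppin Q 0.
Proof. by move=> m; rewrite msupp0. Qed.

Lemma suppinD Q f g : suppin Q f -> suppin Q g -> suppin Q (f + g).
Proof. by move=> Qf Qg m /msuppD_le; rewrite mem_cat => /orP[/Qf|/Qg]. Qed.

Lemma suppinZ Q c f : suppin Q f -> suppin Q (c *: f).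
Proof. by move=> Qf m /msuppZ_le /Qf. Qed.

Lemma suppinN Q f : suppin Q f -> suppin Q (- f).
Proof. by rewrite -scaleN1r; apply: suppinZ. Qed.

Lemma suppinB Q f g : suppin Q f -> suppin Q g -> suppin Q (f - g).
Proof. by move=> Qf Qg; apply/suppinD/suppinN. Qed.

Lemma suppin_sum (I : Type) (r : seq I) (P : pred I) (F : I -> {mpoly K[n]}) Q :
  (forall i, P i -> suppin Q (F i)) -> suppin Q (\sum_(i <- r | P i) F i).
Proof.
move=> QF; apply: (big_ind (suppin Q)) => //; first exact: suppin0.
exact: suppinD.
Qed.

Lemma suppinX Q m : suppin Q 'X_[m] <-> Q m.
Proof.
split=> [|Qm m' /mem_msuppXP <- //]; apply; exact/mem_msuppXP.
Qed.

Lemma suppinM Q1 Q2 Q f g : (forall a b, Q1 a -> Q2 b -> Q (a + b)%MM) ->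
  suppin Q1 f -> suppin Q2 g -> suppin Q (f * g).
Proof.
move=> Q12 Q1f Q2g m /msuppM_le /allpairsP[[a b] /= [fa gb ->]].
by apply: Q12; [apply: Q1f|apply: Q2g].
Qed.

Lemma msize_suppin d f : (msize f <= d)%N <-> suppin [pred m | (mdeg m < d)%N] f.
Proof.
split=> [lefd m /msize_mdeg_lt lt|fd]; first exact: leq_trans lt lefd.
have [->|f0] := eqVneq f 0; first by rewrite msize0.
by rewrite -mlead_deg //; apply/fd/mlead_supp.
Qed.

End SupportedIn.

Section Neglex.
Variable n : nat.
Implicit Types (a b c d m : 'X_{1..n}).

Lemma neglexP a b : reflect
  (exists2 i : 'I_n, (a i < b i)%N & forall j : 'I_n, (i < j)%N -> a j = b j)
  (neglex n a b).
Proof.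
apply: (iffP existsP) => [[i /andP[lti /forallP eqj]]|[i lti eqj]]; exists i => //.
  by move=> j ij; have := eqj j; rewrite ij => /eqP.
by rewrite lti; apply/forallP => j; apply/implyP => /eqj ->.
Qed.

Lemma neglex_irr a : neglex n a a = false.
Proof. by apply/negbTE/negP => /neglexP[l]; rewrite ltnn. Qed.

Lemma neglex_trans : transitive (neglex n).
Proof.
move=> b a c /neglexP[i ltab eqab] /neglexP[j ltbc eqbc]; apply/neglexP.
have [ij|ji|/val_inj eij] := ltngtP i j.
- exists j; first by rewrite eqab.
  by move=> l jl; rewrite eqab ?eqbc // (ltn_trans ij).
- exists i; first by rewrite -eqbc.
  by move=> l il; rewrite eqab ?eqbc // (ltn_trans ji).
- exists i; first by rewrite (ltn_trans ltab) // eij.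
  by move=> l il; rewrite eqab // eqbc // -eij.
Qed.

Definition nle a b := (a == b) || neglex n a b.

Lemma nle_refl a : nle a a. Proof. by rewrite /nle eqxx. Qed.

Lemma neglexW a b : neglex n a b -> nle a b.
Proof. by rewrite /nle => ->; rewrite orbT. Qed.

Lemma neglex_nle_trans a b c : neglex n a b -> nle b c -> neglex n a c.
Proof. by move=> ab /predU1P[<- //|]; apply: neglex_trans. Qed.

Lemma nle_trans : transitive nle.
Proof.
move=> b a c /predU1P[-> //|ab] bc; exact/neglexW/(neglex_nle_trans ab bc).
Qed.

Lemma neglexD a b c d : neglex n a b -> nle c d -> neglex n (a + c)%MM (b + d)%MM.
Proof.
move=> /neglexP[i lti eqi] /predU1P[->|/neglexP[j ltj eqj]]; apply/neglexP.
  exists i; first by rewrite !mnmDE ltn_add2r.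
  by move=> l /eqi e; rewrite !mnmDE e.
have [ij|ji|/val_inj eij] := ltngtP i j.
- exists j; first by rewrite !mnmDE eqi // ltn_add2l.
  by move=> l jl; rewrite !mnmDE eqj // eqi // (ltn_trans ij).
- exists i; first by rewrite !mnmDE eqj // ltn_add2r.
  by move=> l il; rewrite !mnmDE eqi // eqj // (ltn_trans ji).
- exists i; first by rewrite !mnmDE -addnS; apply: leq_add; [apply: ltnW|rewrite eij].
  by move=> l il; rewrite !mnmDE eqi // eqj // -eij.
Qed.

Lemma nleD a b c d : nle a b -> nle c d -> nle (a + c)%MM (b + d)%MM.
Proof.
move=> /predU1P[->|ab cd]; last exact/neglexW/neglexD.
move=> /predU1P[->|cd]; first exact: nle_refl.
by apply: neglexW; rewrite !(addmC b); apply: neglexD => //; apply: nle_refl.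
Qed.

Lemma nleMn a b e : nle a b -> nle (a *+ e)%MM (b *+ e)%MM.
Proof.
move=> ab; elim: e => [|e IHe]; first by rewrite !mulm0n nle_refl.
by rewrite !mulmS; apply: nleD.
Qed.

Lemma nleU (i j : 'I_n) : (i <= j)%N -> nle U_(i)%MM U_(j)%MM.
Proof.
rewrite leq_eqVlt => /orP[/eqP/val_inj -> |ij]; first exact: nle_refl.
apply/neglexW/neglexP; exists j => [|l jl]; rewrite !mnm1E.
  by rewrite eqxx -val_eqE ltn_eqF.
by rewrite -!val_eqE !ltn_eqF // (ltn_trans ij).
Qed.

Variable K : fieldType.
Implicit Types (f g : {mpoly K[n]}).

(** Without its term at [a], [f] lies strictly below [a], so the rest of the product cannot reach
    [a + b]. *)
Lemma mcoeff_nleM f g a b : suppin (nle^~ a) f -> suppin (nle^~ b) g ->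
  (f * g)@_(a + b) = f@_a * g@_b.
Proof.
move=> fa gb; rewrite -{1}(subrK (f@_a *: 'X_[a]) f) mulrDl mcoeffD.
rewrite -scalerAl mcoeffZ (mulrC 'X_[a]) mcoeffMX.
have /suppin_coef e0 : suppin (neglex n ^~ (a + b)%MM) ((f - f@_a *: 'X_[a]) * g).
  apply: (suppinM (Q1 := neglex n ^~ a)) gb => [x y|]; first exact: neglexD.
  move=> m; rewrite mcoeff_msupp mcoeffB mcoeffZ mcoeffX.
  have [<-|nam] := eqVneq a m; first by rewrite mulr1 subrr eqxx.
  rewrite mulr0 subr0 -mcoeff_msupp => /fa; rewrite /nle eq_sym.
  by rewrite (negPf nam).
by rewrite e0 ?add0r // neglex_irr.
Qed.

End Neglex.

Arguments nle {n} a b.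

(** * Flagged Jacobi-Trudi determinants and Demazure characters *)

Section FlaggedDeterminants.
Variables (K : fieldType) (n : nat).
Local Notation P := {mpoly K[n]}.
Implicit Types (s : seq 'I_n) (m e : nat) (a b : 'X_{1..n}).

(** Neglex does not refine the degree, so both are recorded: leading forms need control of the
    degree, and a fixed degree leaves finitely many monomials for the reduction. *)
Definition hnle a b := nle a b && (mdeg a == mdeg b).

Lemma hnle_refl a : hnle a a. Proof. by rewrite /hnle nle_refl eqxx. Qed.

Lemma hnle_trans : transitive hnle.
Proof.
move=> b a c /andP[ab /eqP eab] /andP[bc /eqP ebc].
by rewrite /hnle (nle_trans ab bc) eab ebc eqxx.
Qed.

Lemma hnleD a b (c d : 'X_{1..n}) :
  hnle a b -> hnle c d -> hnle (a + c)%MM (b + d)%MM.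
Proof.
move=> /andP[ab /eqP eab] /andP[cd /eqP ecd].
by rewrite /hnle nleD //= !mdegD eab ecd.
Qed.

Lemma hnleMn a b e : hnle a b -> hnle (a *+ e)%MM (b *+ e)%MM.
Proof. by move=> /andP[ab /eqP eab]; rewrite /hnle nleMn //= !mdegMn eab. Qed.

Lemma hnleU (i j : 'I_n) : (i <= j)%N -> hnle U_(i)%MM U_(j)%MM.
Proof. by move=> ij; rewrite /hnle nleU //= !mdeg1. Qed.

Lemma suppin_hnleM (f g : P) a b :
  suppin (hnle^~ a) f -> suppin (hnle^~ b) g -> suppin (hnle^~ (a + b)%MM) (f * g).
Proof. by apply: suppinM => x y; apply: hnleD. Qed.

Lemma suppin_hnle_prod (I : Type) (r : seq I) (F : I -> P) (E : I -> 'X_{1..n}) :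
  (forall i, suppin (hnle^~ (E i)) (F i)) ->
  suppin (hnle^~ (\sum_(i <- r) E i)%MM) (\prod_(i <- r) F i).
Proof.
move=> FE; elim: r => [|i r IHr]; last by rewrite !big_cons; apply: suppin_hnleM.
by rewrite !big_nil -mpolyX0; apply/suppinX/hnle_refl.
Qed.

Lemma mcoeff_hnle_prod (I : Type) (r : seq I) (F : I -> P) (E : I -> 'X_{1..n}) :
  (forall i, suppin (hnle^~ (E i)) (F i)) ->
  (\prod_(i <- r) F i)@_(\sum_(i <- r) E i)%MM = \prod_(i <- r) (F i)@_(E i).
Proof.
move=> FE; elim: r => [|i r IHr]; first by rewrite !big_nil mcoeff1 eqxx.
rewrite !big_cons mcoeff_nleM ?IHr //.
  by apply: suppinW (FE i) => x /andP[].
by apply: suppinW (suppin_hnle_prod (r := r) FE) => x /andP[].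
Qed.

Definition vars s : seq P := [seq 'X_l | l <- s].

Lemma vars_cons x s : vars (x :: s) = 'X_x :: vars s. Proof. by []. Qed.

Lemma suppin_hsym (t : 'I_n) s m : (forall l, l \in s -> (l <= t)%N) ->
  suppin (hnle^~ (U_(t) *+ m)%MM) (hsym (vars s) m).
Proof.
elim: s m => [|x s IHs] m les.
  rewrite hsym_nil; case: m => [|m]; last exact: suppin0.
  by rewrite -mpolyX0 mulm0n; apply/suppinX/hnle_refl.
rewrite hsym_consE; apply: suppin_sum => c _.
have lecm : (c <= m)%N by rewrite -ltnS.
have -> : (U_(t) *+ m)%MM = (U_(t) *+ c + U_(t) *+ (m - c))%MM.
  by apply/mnmP => l; rewrite mnmDE !mulmnE -mulnDr subnKC.
apply: suppin_hnleM.
  rewrite mpolyXn; apply/suppinX/hnleMn/hnleU/les; exact: mem_head.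
by apply: IHs => l ls; apply: les; rewrite inE ls orbT.
Qed.

Lemma mcoeff_hsym (t : 'I_n) s m : (forall l, l \in s -> (l < t)%N) ->
  (hsym (vars (t :: s)) m)@_(U_(t) *+ m) = 1.
Proof.
move=> lts; elim: m => [|m IHm]; first by rewrite hsym0 mulm0n mcoeff1 eqxx.
rewrite vars_cons hsymS mcoeffD (mulrC 'X_t) {2}mulmS mcoeffMX -vars_cons {}IHm.
suff -> : (hsym (vars s) m.+1)@_(U_(t) *+ m.+1) = 0 by rewrite add0r.
case: s lts => [|x s] lts; first by rewrite hsym_nil mcoeff0.
(* In the variables before [t], the support is bounded by a power of the variable [t.-1], strictly
   below the same power of the variable [t]. *)
have t_gt0 : (0 < t)%N by apply: leq_ltn_trans (lts x (mem_head _ _)).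
have ltt' : (t.-1 < n)%N by apply: leq_ltn_trans (ltn_ord t); apply: leq_pred.
have lts' l : l \in x :: s -> (l <= Ordinal ltt')%N.
  by move=> /lts /=; rewrite -{1}(prednK t_gt0).
have /suppin_coef h := @suppin_hsym (Ordinal ltt') (x :: s) m.+1 lts'.
apply: h; apply/negP => /andP[/predU1P[/mnmP/(_ t) e|/neglexP[l lt eq]] _].
  move: e;  rewrite !mulmnE !mnm1E eqxx -val_eqE /= ltn_eqF //.
  by rewrite -{2}(prednK t_gt0).
move: lt eq; rewrite !mulmnE !mnm1E -!val_eqE /=; have [<-|ne] := eqVneq t.-1 (val l).
  move=> _ /(_ t); rewrite prednK // => /(_ (leqnn _)).
  by rewrite !mulmnE !mnm1E eqxx -val_eqE /= ltn_eqF // prednK.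
by rewrite mul0n ltn0.
Qed.

Definition upto (t : 'I_n) : seq 'I_n := [seq l : 'I_n <- enum 'I_n | (l <= t)%N].

Lemma mem_upto t l : (l \in upto t) = (l <= t)%N.
Proof. by rewrite mem_filter mem_enum andbT. Qed.

Lemma upto_uniq t : uniq (upto t).
Proof. exact/filter_uniq/enum_uniq. Qed.

Lemma perm_upto t :
  perm_eq (upto t) (t :: [seq l : 'I_n <- enum 'I_n | (l < t)%N]).
Proof.
apply: uniq_perm; rewrite ?upto_uniq //=.
  by rewrite filter_uniq ?enum_uniq // mem_filter ltnn.
by move=> l; rewrite mem_upto inE mem_filter mem_enum andbT leq_eqVlt val_eqE.
Qed.

(* Jacobi-Trudi matrix of the flagged Schur polynomial of shape [mu] whose i-th
   row has flag [t i]. *)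
Definition flagmx r (t : 'I_r -> 'I_n) (mu : 'I_r -> nat) : 'M[P]_r :=
  \matrix_(i, j) hsub (vars (upto (t i))) (mu i + j) i.

(** The product of the largest monomials on the diagonal of [flagmx]: entry [(i, i)] is h_(mu i) in
    the variables up to [t i]. *)
Definition flag_exp r (t : 'I_r -> 'I_n) (mu : 'I_r -> nat) : 'X_{1..n} :=
  (\sum_(i < r) U_(t i) *+ mu i)%MM.

Lemma suppin_flagmx r (t : 'I_r -> 'I_n) mu (i j : 'I_r) :
  suppin (hnle^~ (U_(t i) *+ (mu i + j - i))%MM) (flagmx t mu i j).
Proof.
rewrite mxE /hsub; case: leqP => _; last exact: suppin0.
by apply: suppin_hsym => l; rewrite mem_upto.
Qed.

Lemma mcoeff_flagmx r (t : 'I_r -> 'I_n) mu (i j : 'I_r) : (i <= mu i + j)%N ->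
  (flagmx t mu i j)@_(U_(t i) *+ (mu i + j - i)) = 1.
Proof.
move=> le_i; rewrite mxE /hsub le_i.
rewrite (hsym_perm (perm_map _ (perm_upto (t i)))) mcoeff_hsym //.
by move=> l; rewrite mem_filter => /andP[].
Qed.

Section Flag.
Variables (r : nat) (t : 'I_r -> 'I_n) (mu : 'I_r -> nat).
Hypothesis t_incr : forall i j : 'I_r, (i < j)%N -> (t i < t j)%N.
Hypothesis mu_gt0 : forall i, (0 < mu i)%N.

Lemma flag_inj : injective t.
Proof.
move=> i j etij; apply/val_inj; have [/t_incr|/t_incr|//] := ltngtP i j.
  by rewrite etij ltnn.
by rewrite etij ltnn.
Qed.

Lemma flag_expE (nu : 'I_r -> nat) i : flag_exp t nu (t i) = nu i.
Proof.
rewrite mnm_sumE (bigD1 i) //= mulmnE mnm1E eqxx mul1n big1 ?addn0 // => j ji.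
by rewrite mulmnE mnm1E (inj_eq flag_inj) (negPf ji).
Qed.

Lemma flag_exp_out (nu : 'I_r -> nat) l : (forall i, t i != l) -> flag_exp t nu l = 0%N.
Proof.
move=> tl; rewrite mnm_sumE big1 // => i _.
by rewrite mulmnE mnm1E (negPf (tl i)).
Qed.

Lemma flag_exp_neq0 (nu : 'I_r -> nat) l :
  flag_exp t nu l != 0%N -> exists i, t i = l.
Proof.
move=> nu0; have [/existsP[i0 /eqP]|] := boolP [exists i, t i == l].
  by exists i0.
rewrite negb_exists => /forallP tl.
by rewrite flag_exp_out ?eqxx in nu0.
Qed.

(** At the last index moved, [s] takes a smaller value, so the exponent of that variable drops while
    all later ones agree. Positivity of [mu] keeps the drop strict under truncated subtraction. *)
Lemma neglex_perm (s : 'S_r) : s != 1%g ->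
  neglex n (flag_exp t (fun i => mu i + s i - i)%N) (flag_exp t mu).
Proof.
move=> s1; have [i0 nei] : exists i, s i != i.
  apply/existsP; apply: contraR s1; rewrite negb_exists => /forallP e.
  by apply/eqP/permP => i; rewrite perm1; apply/eqP; have := e i; rewrite negbK.
case: (@arg_maxnP _ i0 (fun i => s i != i) val nei) => i1 nei1 max1.
have si1 : (s i1 < i1)%N.
  rewrite ltn_neqAle val_eqE nei1 leqNgt; apply/negP => lt.
  by have := contraNN (max1 (s i1)); rewrite /geq /= -ltnNge (inj_eq perm_inj) => /(_ lt);
    rewrite nei1.
apply/neglexP; exists (t i1) => [|l ltl].
  by rewrite !flag_expE; have := mu_gt0 i1; lia.
have [/existsP[i2 /eqP etl]|] := boolP [exists i, t i == l]; last first.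
  by rewrite negb_exists => /forallP tl; rewrite !flag_exp_out.
rewrite -etl !flag_expE.
have lt12 : (i1 < i2)%N.
  rewrite ltnNge; apply/negP; rewrite leq_eqVlt => /orP[/eqP/val_inj e|/t_incr].
    by rewrite -etl e ltnn in ltl.
  by rewrite etl ltnNge ltnW.
suff /eqP -> : s i2 == i2 by rewrite addnK.
by apply/negPn/negP => /max1; rewrite /geq /= leqNgt lt12.
Qed.

Lemma suppin_perm (s : 'S_r) :
  suppin (hnle^~ (flag_exp t mu)) (\prod_i flagmx t mu i (s i)).
Proof.
(* A row with [mu i + s i < i] contributes a zero entry. Otherwise no subtraction is truncated, and
   the degrees add up to that of [flag_exp t mu]. *)
have [/forallP le_i|] := boolP [forall i : 'I_r, i <= mu i + s i]%N; last first.
  rewrite negb_forall => /existsP[i0 lti].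
  by rewrite (bigD1 i0) //= mxE /hsub (negPf lti) mul0r; apply: suppin0.
apply: suppinW (suppin_hnle_prod (fun i => @suppin_flagmx r t mu i (s i))).
move=> a; rewrite !unfold_in => /hnle_trans; apply.
have [->|s1] := eqVneq s 1%g.
  rewrite (_ : \big[_/_]_(i <- _) _ = flag_exp t mu) ?hnle_refl //.
  by apply: eq_bigr => i _; rewrite perm1 addnK.
rewrite /hnle; apply/andP; split; first exact/neglexW/neglex_perm.
rewrite !mdeg_sum; under eq_bigr do rewrite mdegMn mdeg1 mul1n.
under [X in _ == X]eq_bigr do rewrite mdegMn mdeg1 mul1n.
rewrite -(eqn_add2r (\sum_(i < r) i)) -big_split /=.
under eq_bigr => i _ do rewrite (subnK (le_i i)).
by rewrite big_split /= eqn_add2l [X in _ == X](reindex_inj (@perm_inj _ s)).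
Qed.

Lemma suppin_det_flagmx : suppin (hnle^~ (flag_exp t mu)) (\det (flagmx t mu)).
Proof.
apply: suppin_sum => s _.
by case: odd_perm; rewrite ?expr0 ?mul1r ?expr1 ?mulN1r; do ?apply: suppinN;
  apply: suppin_perm.
Qed.

(* In the Leibniz expansion only the diagonal reaches the monomial
   [flag_exp t mu]. *)
Lemma mcoeff_det_flagmx : (\det (flagmx t mu))@_(flag_exp t mu) = 1.
Proof.
rewrite raddf_sum (bigD1 1%g) //= odd_perm1 expr0 mul1r.
rewrite [X in _ + X]big1 ?addr0 => [|s s1]; last first.
  suff e : (\prod_i flagmx t mu i (s i))@_(flag_exp t mu) = 0.
    by case: odd_perm; rewrite ?expr0 ?mul1r ?expr1 ?mulN1r ?mcoeffN e ?oppr0.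
  have := suppin_hnle_prod (r := index_enum _) (fun i => @suppin_flagmx r t mu i (s i)).
  move=> /suppin_coef h; apply: h; apply/negP => /andP[/predU1P[e|le] _]; have lt := neglex_perm s1.
    suff: neglex n (flag_exp t mu) (flag_exp t mu) by rewrite neglex_irr.
    by rewrite {1}e.
  by have := neglex_trans lt le; rewrite neglex_irr.
have e i : (mu i + (1%g : 'S_r) i - i)%N = mu i by rewrite perm1 addnK.
have := mcoeff_hnle_prod (index_enum _)
  (fun i => @suppin_flagmx r t mu i ((1%g : 'S_r) i)).
under [X in _@_X]eq_bigr => i _ do rewrite e.
move=> ->; apply: big1 => i _; apply: mcoeff_flagmx.
by rewrite perm1 leq_addl.
Qed.

End Flag.

End FlaggedDeterminants.

Arguments hnle {n} a b.

(** * Divided differences of flagged determinants *)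

Section DemazureFlag.
Variables (K : fieldType) (n : nat).
Local Notation P := {mpoly K[n]}.

Lemma rmorph_hsym (A B : comNzRingType) (f : {rmorphism A -> B}) (s : seq A) m :
  f (hsym s m) = hsym (map f s) m.
Proof.
elim: s m => [|x s IHs] m; first by rewrite !hsym_nil rmorph_nat.
rewrite map_cons !hsym_consE rmorph_sum; apply: eq_bigr => c _.
by rewrite rmorphM rmorphXn IHs.
Qed.

Lemma rmorph_hsub (A B : comNzRingType) (f : {rmorphism A -> B}) (s : seq A) m d :
  f (hsub s m d) = hsub (map f s) m d.
Proof. by rewrite /hsub; case: leqP => _; rewrite ?rmorph0 ?rmorph_hsym. Qed.

Lemma msymXU (s : 'S_n) (l : 'I_n) : msym s ('X_l : P) = 'X_(s l).
Proof.
rewrite msymX; congr 'X_[_]; apply/mnmP => i.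
by rewrite !mnmE (canF_eq (permK s)).
Qed.

Lemma msym_vars (s : 'S_n) (r : seq 'I_n) :
  map (msym s) (vars K r) = vars K (map s r).
Proof. by rewrite /vars -!map_comp; apply: eq_map => l /=; rewrite msymXU. Qed.

Section Adjacent.
Variables a b : 'I_n.
Hypothesis ab : b = a.+1 :> nat.

Let neq_ab : a != b. Proof. by rewrite -val_eqE /= ab neq_ltn ltnSn. Qed.

Lemma perm_upto_tperm (t : 'I_n) : t != a ->
  perm_eq (map (tperm a b) (upto t)) (upto t).
Proof.
move=> neta; apply: uniq_perm; rewrite ?upto_uniq //.
  by rewrite map_inj_uniq ?upto_uniq //; apply: perm_inj.
move=> l; rewrite mem_upto -{1}(tpermK a b l) mem_map ?mem_upto; last first.
  exact: perm_inj.
have {}neta : (t : nat) != a by [].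
by case: tpermP => [->|->|//]; lia.
Qed.

Lemma perm_upto_succ :
  perm_eq (upto b) [:: b, a & [seq l : 'I_n <- enum 'I_n | (l < a)%N]].
Proof.
apply: perm_trans (perm_upto b) _; rewrite perm_cons.
rewrite [X in perm_eq X _](_ : _ = upto a) ?perm_upto //.
by apply: eq_filter => l; rewrite ab ltnS.
Qed.

(** The divided difference adjoins [b] to a flag ending in [a]: the smaller variables are fixed by
    the transposition, so [hsub_swap_sub] applies. *)
Lemma hsub_divdiff m d :
  ('X_a - 'X_b) * hsub (vars K (upto b)) m d
    = 'X_a * hsub (vars K (upto a)) m d
      - 'X_b * msym (tperm a b) (hsub (vars K (upto a)) m d).
Proof.
set low := [seq l : 'I_n <- enum 'I_n | (l < a)%N].
rewrite rmorph_hsub msym_vars.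
have pa := perm_upto a; rewrite -/low in pa.
rewrite (hsub_perm (perm_map _ pa)) (hsub_perm (perm_map _ (perm_map _ pa))).
have pab : perm_eq (upto b) [:: a, b & low].
  apply: perm_trans perm_upto_succ _.
  by rewrite (perm_catCA [:: b] [:: a] low).
rewrite (hsub_perm (perm_map _ pab)) /= tpermL.
suff -> : map (tperm a b) low = low by rewrite hsub_swap_sub.
rewrite -[RHS]map_id; apply/eq_in_map => l; rewrite mem_filter => /andP[la _].
by rewrite tpermD // -val_eqE /= ?ab gtn_eqF // ltnW.
Qed.

(** Outside row [i0], a flag contains both or neither of [a] and [b], so its row is invariant under
    the transposition. Linearity of the determinant in row [i0] then reduces the claim to
    [hsub_divdiff]. *)
Lemma det_flagmx_divdiff r (t t' : 'I_r -> 'I_n) mu i0 :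
    t i0 = b -> t' i0 = a -> (forall i, i != i0 -> t' i = t i) ->
    (forall i, t i != a) ->
  ('X_a - 'X_b) * \det (flagmx K t mu)
    = 'X_a * \det (flagmx K t' mu)
      - 'X_b * msym (tperm a b) (\det (flagmx K t' mu)).
Proof.
move=> ti0 t'i0 t't ta.
have nl i : (lift i0 i == i0) = false by rewrite eq_sym (negPf (neq_lift _ _)).
pose C := \matrix_(i, j) (if i == i0 then ('X_a - 'X_b) * flagmx K t mu i0 j
                          else flagmx K t mu i j).
have detC : \det C = ('X_a - 'X_b) * \det (flagmx K t mu).
  rewrite (@determinant_multilinear _ _ _ (flagmx K t mu) (flagmx K t mu) i0
    ('X_a - 'X_b) 0) ?mul0r ?addr0 //.
  - by apply/rowP => j; rewrite !mxE eqxx mul0r addr0.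
  - by apply/matrixP => i j; rewrite !mxE nl.
  - by apply/matrixP => i j; rewrite !mxE nl.
rewrite -detC -mulNr -det_map_mx.
apply: (@determinant_multilinear _ _ _ _ _ i0).
- by apply/rowP => j; rewrite !mxE eqxx ti0 t'i0 hsub_divdiff mulNr.
- by apply/matrixP => i j; rewrite !mxE nl t't // nl.
- apply/matrixP => i j; rewrite !mxE nl t't ?nl // rmorph_hsub msym_vars.
  by apply: hsub_perm; apply: perm_map; apply: perm_upto_tperm.
Qed.

End Adjacent.

Lemma vars_upto_mkseq (t : 'I_n) :
  vars K (upto t) = mkseq (fun l => if insub l is Some i then 'X_i else 0) t.+1.
Proof.
set x := fun l : nat => _.
rewrite /mkseq -(filter_iota_leq (n := n) 0) // -val_enum_ord filter_map -map_comp.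
by rewrite /vars; apply: eq_map => l; rewrite /x /= valK.
Qed.

(** Each Demazure step moves one flag from [a] to [b], and a dominant exponent forces the flags 0,
    1, .., for which the determinant is a monomial. In particular [p] does not depend on the
    derivation. *)
Lemma demazure_det r (t : 'I_r -> 'I_n) (mu : 'I_r -> nat) (g : 'X_{1..n}) p :
    (forall i j : 'I_r, (i < j)%N -> (t i < t j)%N) ->
    (forall i, (0 < mu i)%N) -> (forall i j : 'I_r, (i <= j)%N -> (mu j <= mu i)%N) ->
    g = flag_exp t mu -> demazure g p ->
  p = \det (flagmx K t mu).
Proof.
move=> t_incr mu_gt0 mu_decr eg dg; elim: dg t t_incr eg => {g p}.
  move=> g g_decr t t_incr eg.
  (* Dominance leaves no gap: the exponent at position [i] is at least the positive one at [t i], so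
     [i] is itself some [t j]. *)
  have tE (i : 'I_r) : t i = i :> nat.
    have [N] := ubnP (i : nat); elim: N i => // N IHN i; rewrite ltnS => leiN.
    have let_i : (i <= t i)%N.
      case: i leiN => -[//|l] ltl /= leN.
      have ltl' := ltnW ltl.
      have := t_incr (Ordinal ltl') (Ordinal ltl) (ltnSn l).
      by rewrite (IHN (Ordinal ltl')).
    have lt_in : (i < n)%N by apply: leq_ltn_trans (ltn_ord (t i)).
    have [j etj] : exists j, t j = Ordinal lt_in.
      apply: (@flag_exp_neq0 n r t mu); rewrite -eg -lt0n.
      apply: leq_trans (g_decr (Ordinal lt_in) (t i) let_i).
      by rewrite eg flag_expE.
    have [lt_ji|le_ij] := ltnP j i.
      have := IHN j (leq_trans lt_ji leiN).
      by rewrite etj /= => e; rewrite e ltnn in lt_ji.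
    apply/eqP; rewrite eqn_leq let_i andbT.
    have := congr1 val etj => /= etj'; rewrite -etj'.
    move: le_ij; rewrite leq_eqVlt => /orP[/eqP/val_inj -> //|/t_incr].
    exact: ltnW.
  pose x l : P := if insub l is Some i then 'X_i else 0.
  pose mu' l := if insub l is Some i then mu i else 0%N.
  rewrite eg /flag_exp (_ : flagmx K t mu
      = \matrix_(i < r, j < r) hsub (mkseq x i.+1) (mu' i + j) i).
    rewrite det_hsub_flag -mprodXE; apply: eq_bigr => i _.
    by rewrite -mpolyXn /x /mu' valK -tE valK.
  by apply/matrixP => i j; rewrite !mxE vars_upto_mkseq tE /mu' valK.
move=> g a b p q ab ltg dp IHp Eq t t_incr eg.
have [i0 ti0] : exists i0, t i0 = b.
  apply: (@flag_exp_neq0 n r t mu); rewrite -eg -lt0n.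
  exact: leq_ltn_trans ltg.
(* If [a] were also a flag it would precede [b], and [mu] being weakly decreasing would contradict
   [g a < g b]. *)
have ta i : t i != a.
  apply/eqP => tia; have : (i < i0)%N.
    rewrite ltnNge; apply/negP; rewrite leq_eqVlt => /orP[/eqP/val_inj e|/t_incr].
      by move: tia; rewrite -e ti0 => /(congr1 val) /=; rewrite ab; lia.
    by rewrite tia ti0 ab; lia.
  move=> /ltnW /mu_decr; rewrite leqNgt => /negP; apply.
  by move: ltg; rewrite eg -ti0 -tia !flag_expE.
pose t' i := if i == i0 then a else t i.
have t'_incr (i j : 'I_r) : (i < j)%N -> (t' i < t' j)%N.
  move=> ij; rewrite /t'; have [ei|nei] := eqVneq i i0; have [ej|nej] := eqVneq j i0.
  - by rewrite ei ej ltnn in ij.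
  - by have := t_incr _ _ ij; rewrite ei ti0 ab; apply: ltnW.
  - have := t_incr _ _ ij; rewrite ej ti0 ab ltnS leq_eqVlt => /orP[|//].
    by rewrite val_eqE (negPf (ta i)).
  - exact: t_incr.
have et' : swap_exponents a b g = flag_exp t' mu.
  apply/mnmP => l; rewrite mnmE.
  have [/existsP[i1 /eqP <-]|] := boolP [exists i, t' i == l].
    rewrite flag_expE // /t'; have [->|ne] := eqVneq i1 i0.
      by rewrite tpermL eg -ti0 flag_expE.
    rewrite tpermD ?eg ?flag_expE // 1?eq_sym //.
    by rewrite -ti0 (inj_eq (flag_inj t_incr)).
  rewrite negb_exists => /forallP t'l; rewrite flag_exp_out; last first.
    by move=> i; apply: t'l.
  rewrite eg; have := t'l i0; rewrite /t' eqxx => nal.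
  case: tpermP => [e|_|_ nlb]; first by rewrite e eqxx in nal.
    by rewrite flag_exp_out.
  apply: flag_exp_out => i; have [->|ne] := eqVneq i i0.
    by rewrite ti0 eq_sym; apply/eqP.
  by have := t'l i; rewrite /t' (negPf ne).
have Ep := IHp _ t'_incr et'.
(* [demazure_step] has its denominator cleared; [q] is recovered by cancelling this factor. *)
have nz : 'X_a - 'X_b != 0 :> P.
  rewrite subr_eq0; apply/eqP => /mpolyP/(_ U_(a)%MM).
  rewrite !mcoeffXU eqxx [b == a](_ : _ = false) => [/eqP|]; first by rewrite oner_eq0.
  by rewrite -val_eqE /= ab gtn_eqF.
apply: (mulfI nz); rewrite Eq Ep; symmetry.
apply: (@det_flagmx_divdiff _ _ ab _ t t' mu i0) => //; rewrite /t' ?eqxx //.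
by move=> i /negPf ->.
Qed.

Lemma coef_prod_vars (l : nat) :
  (\prod_(i : 'I_n) (1 - 'X_i *: 'X) : {poly P})`_l = (-1) ^+ l * mesym n K l.
Proof.
have -> : (\prod_(i : 'I_n) (1 - 'X_i *: 'X) : {poly P})
    = \sum_(J : {set 'I_n}) ((-1) ^+ #|J| * \prod_(i in J) 'X_i) *: 'X^#|J|.
  under eq_bigr => i _ do rewrite addrC.
  rewrite bigA_distr; apply: eq_bigr => J _.
  rewrite -big_mkcond /=; under eq_bigr => i _ do rewrite -scaleNr.
  by rewrite scaler_prod prodr_const prodrN.
rewrite coef_sum /mesym mulr_sumr big_mkcond [RHS]big_mkcond.
apply: eq_bigr => J _; rewrite coefZ coefXn eq_sym.
by case: eqP => [->|]; rewrite ?mulr1 ?mulr0.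
Qed.

End DemazureFlag.

(** * Flagged determinants in ideals containing elementary symmetric polynomials *)

Section FlaggedInIdeal.
Variables (K : fieldType) (n : nat).
Local Notation P := {mpoly K[n]}.
Variable J : ideal P.

Lemma idealN (f : P) : ideal_set J f -> ideal_set J (- f).
Proof. by rewrite -mulN1r; apply: idealM. Qed.

Lemma idealMr (f g : P) : ideal_set J f -> ideal_set J (f * g).
Proof. by rewrite mulrC; apply: idealM. Qed.

Lemma idealB (f g : P) : ideal_set J f -> ideal_set J g -> ideal_set J (f - g).
Proof. by move=> Jf Jg; apply/idealD/idealN. Qed.

Lemma idealZ c (f : P) : ideal_set J f -> ideal_set J (c *: f).
Proof. by rewrite -mul_mpolyC; apply: idealM. Qed.

Lemma ideal_sum (I : Type) (r : seq I) (Q : pred I) (F : I -> P) :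
  (forall i, Q i -> ideal_set J (F i)) -> ideal_set J (\sum_(i <- r | Q i) F i).
Proof.
move=> JF; apply: (big_ind (ideal_set J)) => //; first exact: ideal0.
by move=> a b; apply: idealD.
Qed.

(* In the generating function identity
     \prod_(i : 'I_n) (1 - x_i Z) / \prod_(i <= t) (1 - x_i Z)
       = \prod_(i > t) (1 - x_i Z),
   the right-hand side has degree less than [n - t]. *)
Lemma sum_mesym_hsub (t : 'I_n) :
  \sum_(l < n.+1) (-1) ^+ l * mesym n K l * hsub (vars K (upto t)) (n - t) l = 0.
Proof.
pose q : {poly P} := \prod_(i : 'I_n | ~~ (i <= t)%N) (1 - 'X_i *: 'X).
have Eq : q * \prod_(x <- vars K (upto t)) (1 - x *: 'X)
    = \prod_(i : 'I_n) (1 - 'X_i *: 'X).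
  by rewrite [RHS](bigID (fun i : 'I_n => (i <= t)%N)) /= mulrC big_map
    big_filter big_enum_cond.
have szq : (size q <= n - t)%N.
  apply: leq_trans (size_prod_1subZX _ _) _.
  have := cardC [pred i : 'I_n | (i <= t)%N]; rewrite card_ord.
  rewrite -(eq_card (mem_upto t)) (card_uniqP (upto_uniq t)).
  rewrite -(size_map (fun l => 'X_l : P)) -/(vars K _) vars_upto_mkseq size_mkseq.
  rewrite (@eq_card _ _ [pred i : 'I_n | ~~ (i <= t)%N]) // => e.
  by rewrite -[X in (_ <= X - _)%N]e addSnnS addKn.
have := coef_conv_hsym (vars K (upto t)) q (n - t).
rewrite Eq [RHS]nth_default // => e; rewrite -[RHS]e.
rewrite (big_ord_widen_cond n.+1 xpredT (fun l => (\prod_(i : 'I_n) (1 - 'X_i *: 'X))`_l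
  * hsym (vars K (upto t)) (n - t - l))); last by rewrite ltnS leq_subr.
rewrite [RHS]big_mkcond; apply: eq_bigr => l _.
by rewrite coef_prod_vars /hsub ltnS /=; case: leqP => _; rewrite ?mulr0.
Qed.

(** Cramer's rule: the matrix sends the vector [v] of signed elementary symmetric polynomials into
    [J], so the adjugate puts the determinant times [v] into [J], and the last entry of [v] is e_0 =
    1. *)
Lemma det_flagmx_ideal k r (t : 'I_r.+1 -> 'I_n) (mu : 'I_r.+1 -> nat) :
    (r + k)%N = n -> (forall i, mu i + t i = k + i)%N ->
    (forall d, (r < d <= n)%N -> ideal_set J (mesym n K d)) ->
  ideal_set J (\det (flagmx K t mu)).
Proof.
move=> rk mut Je.
pose v : 'cV[P]_r.+1 := \col_j ((-1) ^+ (r - j) * mesym n K (r - j)).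
have JMv i : ideal_set J ((flagmx K t mu *m v) i 0).
  have lt_rn : (r.+1 <= n.+1)%N by lia.
  have := sum_mesym_hsub (t i).
  (* The terms with [l <= r], in reversed order, form the entry of the matrix product; the others
     are multiples of e_l with [r < l <= n], hence in [J]. *)
  rewrite (bigID (fun l : 'I_n.+1 => (l < r.+1)%N)) /=.
  rewrite -(big_ord_widen _ (fun l => (-1) ^+ l * mesym n K l
    * hsub (vars K (upto (t i))) (n - t i) l) lt_rn).
  move=> /eqP; rewrite addr_eq0 (reindex_inj rev_ord_inj) /= => /eqP e.
  rewrite mxE (_ : \sum_j _ = \sum_(j < r.+1) (-1) ^+ (r.+1 - j.+1)
      * mesym n K (r.+1 - j.+1) * hsub (vars K (upto (t i))) (n - t i) (r.+1 - j.+1)).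
    rewrite e; apply/idealN/ideal_sum => l; rewrite -leqNgt => lt_rl.
    by apply/idealMr/idealM/Je; rewrite lt_rl -ltnS ltn_ord.
  apply: eq_bigr => j _; rewrite !mxE mulrC subSS; congr (_ * _).
  have muti := mut i; have ltt := ltn_ord (t i); have ltj := ltn_ord j.
  rewrite /hsub (_ : (r - j <= n - t i)%N = (i <= mu i + j)%N); last by lia.
  by case: leqP => // le; congr hsym; lia.
have := mul_adj_mx (flagmx K t mu).
move=> /(congr1 (fun A => (A *m v) ord_max 0)).
rewrite mul_scalar_mx -mulmxA !mxE subnn expr0 mesym0E !mulr1 => <-.
by apply: ideal_sum => i _; apply: idealM.
Qed.

End FlaggedInIdeal.

(** * Substaircases, Fubini words and skip sequences *)

Section Greedy.
Implicit Types (s u : seq nat) (j k c : nat).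

(** In state [j] the staircase entries [j.-1], .., 0 remain to be placed. The greedy choice places
    [j.-1] as soon as it bounds the current letter [a], and uses an entry [k.-1] otherwise. *)
Definition gstep j a := if (a < j)%N then j.-1 else j.

Fixpoint accept j s := if s is a :: s' then accept (gstep j a) s' else j == 0%N.

Lemma accept_size j s : accept j s -> (j <= size s)%N.
Proof.
elim: s j => [|a s IHs] j /=; first by move/eqP->.
by move/IHs; rewrite /gstep; case: ltnP => _; lia.
Qed.

Lemma rev_iotaS j : rev (iota 0 j.+1) = j :: rev (iota 0 j).
Proof. by rewrite -addn1 iotaD rev_cat add0n. Qed.

(** The greedy choice is optimal: its state [j'] stays at most the number [j] of entries that the
    given shuffle still has to place. *)
Lemma shuffle_accept k c j j' s u :
    (j' <= j <= k)%N -> (0 < k)%N -> shuffle (rev (iota 0 j)) (nseq c k.-1) u ->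
    size s = size u -> (forall i, (i < size s)%N -> (nth 0 s i <= nth 0 u i)%N) ->
  all (fun a => a < k)%N s && accept j' s.
Proof.
move=> + k_gt0 [m [+ + +]]; elim: m c j j' s u => [|b m IHm] c j j' s u.
  move=> jk; case: u => // _ mj _; case: s => // _ _ /=; case: j mj jk => [|j].
    by rewrite leqn0 => _ /andP[].
  by rewrite rev_iotaS.
case: u s => [|x u] [|a s] // /andP[lej'j lejk] [sz] mu mnu [szs] le_su.
have le_ax := le_su 0%N isT.
have {}le_su i : (i < size s)%N -> (nth 0 s i <= nth 0 u i)%N by apply: (le_su i.+1).
rewrite /= in le_ax; case: b mu mnu => /=.
  case: j lej'j lejk => [|j] lej'j lejk; rewrite ?rev_iotaS // => -[ex mu] mnu.
  have /andP[-> ->] : all (fun a => a < k)%N s && accept (gstep j' a) s.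
    by apply: (IHm c j _ _ u) => //; rewrite /gstep; case: ltnP => ?; lia.
  by rewrite !andbT; lia.
case: c => [|c] // mu [ex mnu].
have /andP[-> ->] : all (fun a => a < k)%N s && accept (gstep j' a) s.
  by apply: (IHm c j _ _ u) => //; rewrite /gstep; case: ltnP => ?; lia.
by rewrite !andbT; lia.
Qed.

Lemma accept_shuffle k j s : all (fun a => a < k)%N s -> accept j s ->
  exists u, [/\ shuffle (rev (iota 0 j)) (nseq (size s - j) k.-1) u,
    size u = size s & forall i, (nth 0 s i <= nth 0 u i)%N].
Proof.
elim: s j => [|a s IHs] j /=.
  by move=> _ /eqP ->; exists [::]; split=> //; exists [::].
move=> /andP[ltak ltsk] acc; have le_j := accept_size acc.
have [u [[m [szm mu mnu] szu le_su]]] := IHs _ ltsk acc.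
move: mu mnu le_j; rewrite /gstep; case: (ltnP a j) => [ltaj|leja] mu mnu le_j.
  exists (j.-1 :: u); split=> [||[|i]] //=; first 2 last.
  - by lia.
  - exists (true :: m); split=> /=; first by rewrite szm.
      by rewrite mu; case: (j) ltaj => // l _; rewrite rev_iotaS.
    by rewrite mnu; congr nseq; lia.
  - by rewrite szu.
exists (k.-1 :: u); split=> [||[|i]] //=; first 2 last.
- by lia.
- exists (false :: m); split=> /=; [by rewrite szm | by [] |].
  by rewrite mnu subSn.
- by rewrite szu.
Qed.

Section Exponents.
Variables (n k : nat).
Hypotheses (k_gt0 : (0 < k)%N) (le_kn : (k <= n)%N).

(** Decidable form of membership in E_(n,k), by [substaircaseE]. *)
Definition nonskip (m : 'X_{1..n}) := all (fun a => a < k)%N m && accept k m.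

Lemma substaircaseE (m : 'X_{1..n}) : substaircase k m <-> nonskip m.
Proof.
have szm : size m = n by rewrite size_tuple.
split=> [[u su le_mu]|/andP[ltmk /(accept_shuffle ltmk)[u [su szu le_mu]]]].
  have szu : size u = n.
    case: su => b [szb /(congr1 size) + /(congr1 size)].
    rewrite !size_mask ?size_map // size_rev size_iota size_nseq count_map.
    by have := count_predC id b; rewrite -szb => <- -> /= ->; rewrite subnKC.
  apply: shuffle_accept su _ _ => //; rewrite ?leqnn // ?szm ?szu // => i lti.
  by have := le_mu (Ordinal lti); rewrite (mnm_nth 0%N).
rewrite szm in su; exists u => // i; rewrite (mnm_nth 0%N); exact: le_mu.
Qed.

End Exponents.
End Greedy.

(** * Counting substaircases by Fubini words *)

Section Counting.
Variable k : nat.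

Lemma sum_tuple_cons (T : finType) n (F : n.+1.-tuple T -> nat) :
  (\sum_t F t = \sum_(c : T) \sum_(t : n.-tuple T) F [tuple of c :: t])%N.
Proof.
rewrite pair_bigA (reindex (fun p : T * n.-tuple T => [tuple of p.1 :: p.2])) //=.
exists (fun t : n.+1.-tuple T => (thead t, [tuple of behead t])) => [[c t]|t] _ /=.
  by rewrite theadE; congr (_, _); apply: val_inj.
by rewrite -tuple_eta.
Qed.

(* The greedy state is the number of letters that have not been seen yet. *)
Lemma count_accept n (U : {set 'I_k}) :
  (\sum_(t : n.-tuple 'I_k) accept #|U| (map val t)
     = \sum_(t : n.-tuple 'I_k) (U \subset [set c in t]%SET))%N.
Proof.
elim: n U => [|n IHn] U.
  rewrite !(big_pred1 [tuple]); try by move=> t; rewrite [t]tuple0 /= eqxx.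
  rewrite /= cards_eq0 (_ : [set c in [tuple]]%SET = finset.set0) ?finset.subset0 //.
rewrite !sum_tuple_cons.
transitivity (\sum_(c : 'I_k) \sum_(t : n.-tuple 'I_k)
    accept (if (c < #|U|)%N then #|U|.-1 else #|U|) (map val t))%N.
  by [].
(* Only the number of letters lowering the state matters: [c < #|U|] and [c \in U] each hold for
   [#|U|] letters. *)
transitivity (\sum_(c : 'I_k) \sum_(t : n.-tuple 'I_k)
    accept (if c \in U then #|U|.-1 else #|U|) (map val t))%N; last first.
  apply: eq_bigr => c _.
  rewrite (_ : (if c \in U then #|U|.-1 else #|U|) = #|U :\ c|%SET); last first.
    by rewrite (cardsD1 c U); case: (c \in U).
  rewrite IHn; apply: eq_bigr => t _; congr nat_of_bool.
  rewrite finset.subDset (_ : [set d in [tuple of c :: t]]%SET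
    = (finset.set1 c :|: [set d in t])%SET) //.
  by apply/finset.setP => d; rewrite !finset.inE.
have leUk : (#|U| <= k)%N by rewrite -[X in (_ <= X)%N]card_ord max_card.
set f := fun j : nat => (\sum_(t : n.-tuple 'I_k) accept j (map val t))%N.
have sum2 (A : pred 'I_k) : (\sum_(c : 'I_k) f (if A c then #|U|.-1 else #|U|)
    = #|A| * f #|U|.-1 + (k - #|A|) * f #|U|)%N.
  rewrite (bigID A) /=.
  rewrite (eq_bigr (fun=> f #|U|.-1)) => [|c ->] //.
  rewrite [X in (_ + X)%N](eq_bigr (fun=> f #|U|)) => [|c /negPf ->] //.
  rewrite !sum_nat_const; congr (_ + _ * _)%N.
  have := cardC A; rewrite card_ord => eA.
  by rewrite -[X in (X - _)%N]eA addKn; apply: eq_card.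
rewrite (sum2 (fun c => (c < #|U|)%N)) (sum2 (mem U)).
rewrite (_ : #|_| = #|U|) //.
transitivity (\sum_(c < k | (c < #|U|)%N) 1)%N; first by rewrite sum1_card.
by rewrite (big_ord_narrow leUk) sum1_card card_ord.
Qed.

Definition accepted n := {t : n.-tuple 'I_k | accept k (map val t)}.
HB.instance Definition _ n := Finite.on (accepted n).

Lemma card_accepted n : #|{: accepted n}| = #|{: fubini_word n k}|.
Proof.
rewrite !card_sig.
pose h (t : n.-tuple 'I_k) := [ffun i => tnth t i].
have h_inj : injective h.
  move=> t u /ffunP e; apply: eq_from_tnth => i.
  by have := e i; rewrite !ffunE.
transitivity (\sum_(t : n.-tuple 'I_k) accept k (map val t))%N.
  by rewrite -sum1_card big_mkcond /=; apply: eq_bigr => t _; rewrite inE; case: accept.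
have := count_accept n [set: 'I_k]%SET; rewrite cardsT card_ord => ->.
rewrite -sum1_card [RHS]big_mkcond /= [RHS](reindex h) /=; last first.
  exists (fun w : {ffun 'I_n -> 'I_k} => [tuple w i | i < n]) => [t|w] _.
    by apply: eq_from_tnth => i; rewrite tnth_mktuple ffunE.
  by apply/ffunP => i; rewrite ffunE tnth_mktuple.
apply: eq_bigr => t _.
suff -> : ([set: 'I_k] \subset [set c in t])%SET = is_fubini (h t).
  by rewrite inE; case: is_fubini.
apply/fintype.subsetP/forallP => [ht a|ht a _].
  have := ht a (finset.in_setT _); rewrite finset.inE => /tnthP[i ->].
  by apply/existsP; exists i; rewrite ffunE.
have /existsP[i /eqP <-] := ht a.
by rewrite finset.inE ffunE mem_tnth.
Qed.

End Counting.

(** * Skip sequences as flags, and divisibility by skip monomials *)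

Section SkipSequences.
Variables (n k r : nat).
Hypothesis rk : (r + k = n)%N.

Lemma sorted_enum_ord : sorted (fun x y : 'I_n => (x < y)%N) (enum 'I_n).
Proof.
by have := iota_ltn_sorted 0 n; rewrite -val_enum_ord sorted_map.
Qed.

Lemma sorted_nth_incr x0 (s : seq 'I_n) (i j : nat) :
    sorted (fun x y : 'I_n => (x < y)%N) s -> (i < j < size s)%N ->
  (nth x0 s i < nth x0 s j)%N.
Proof.
move=> sorted_s /andP[ij js].
have tr : transitive (fun x y : 'I_n => (x < y)%N) by move=> y x z; apply: ltn_trans.
by apply: (sorted_ltn_nth tr x0 sorted_s) => //; rewrite inE // (ltn_trans ij).
Qed.

Section Increasing.
Variable t : 'I_r.+1 -> 'I_n.
Hypothesis t_incr : forall i j : 'I_r.+1, (i < j)%N -> (t i < t j)%N.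

Lemma incr_gap (i j : 'I_r.+1) : (i <= j)%N -> (t i + (j - i) <= t j)%N.
Proof.
case: j => j; elim: j => [|j IHj] ltj /=.
  by rewrite leqn0 => /eqP i0; rewrite i0 addn0 (_ : Ordinal ltj = i) //; apply: val_inj.
rewrite leq_eqVlt => /orP[/eqP eij|].
  by rewrite eij subnn addn0 (_ : Ordinal ltj = i) //; apply: val_inj.
rewrite ltnS => leij; have := IHj (ltnW ltj) leij.
have := t_incr (i := Ordinal (ltnW ltj)) (j := Ordinal ltj) (ltnSn j).
by move=> /=; lia.
Qed.

(** After reversal, [t i] comes from the 1-based position [n - t i], of rank [r.+1 - i] in the set,
    and the skip entry there is [n - t i - (r.+1 - i) + 1]. *)
Definition skip_part (i : 'I_r.+1) := (k + i - t i)%N.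

Lemma skip_partP i : (0 < skip_part i)%N /\ (skip_part i + t i = k + i)%N.
Proof.
have := incr_gap (i := i) (j := ord_max) (leq_ord i).
by have := ltn_ord (t ord_max); have := ltn_ord i; rewrite /skip_part /=; lia.
Qed.

Lemma skip_part_decr (i j : 'I_r.+1) : (i <= j)%N -> (skip_part j <= skip_part i)%N.
Proof. by move=> ij; have := incr_gap ij; rewrite /skip_part; lia. Qed.

Lemma skip_seq_flag :
  rev_exponents (skip_seq [set rev_ord (t i) | i : 'I_r.+1]%SET) = flag_exp t skip_part.
Proof.
have rt_inj : injective (fun i => rev_ord (t i)).
  by move=> i j /rev_ord_inj /(flag_inj t_incr).
apply/mnmP => p; rewrite !mnmE.
have [/existsP[i /eqP <-]|] := boolP [exists i, t i == p]; last first.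
  rewrite negb_exists => /forallP tp; rewrite flag_exp_out // ifN //.
  apply/imsetP => -[i _ /rev_ord_inj e].
  by have := tp i; rewrite e eqxx.
rewrite flag_expE // ifT; last by apply/imsetP; exists i.
(* The elements of the set up to [rev_ord (t i)] are the [rev_ord (t j)] with [i <= j]. *)
rewrite (_ : #|_| = r.+1 - i)%N.
  have [] := skip_partP i; have := ltn_ord (t i); have := ltn_ord i => /=.
  by rewrite /skip_part; lia.
rewrite (_ : [set _ in _ | _]%SET
    = [set rev_ord (t j) | j in [set j : 'I_r.+1 | (i <= j)%N]]%SET); last first.
  apply/finset.setP => x; rewrite !finset.inE; apply/andP/imsetP.
    move=> [/imsetP[j _ ->]] /= le; exists j => //.
    rewrite finset.inE leqNgt; apply/negP => /t_incr.
    by have := ltn_ord (t i); have := ltn_ord (t j); lia.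
  move=> [j]; rewrite finset.inE => ij ->; split; first by apply/imsetP; exists j.
  by have := incr_gap ij => /=; lia.
rewrite card_imset // -[RHS]card_ord.
rewrite -(card_imset _ (f := fun j : 'I_(r.+1 - i) => rev_ord (widen_ord (leq_subr i r.+1) j))).
  apply: eq_card => j; rewrite finset.inE; apply/idP/imsetP => [ij|[l _ ->] /=].
    have lt : (r - j < r.+1 - i)%N by have := ltn_ord j; lia.
    exists (Ordinal lt) => //; apply: val_inj => /=; have := ltn_ord j; lia.
  by have := ltn_ord l; have := ltn_ord i; lia.
by move=> a b /rev_ord_inj /(congr1 val) /= /val_inj.
Qed.

Lemma card_skip_set : #|[set rev_ord (t i) | i : 'I_r.+1]%SET| = r.+1.
Proof.
rewrite card_imset ?card_ord // => i j /rev_ord_inj; exact: flag_inj.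
Qed.

End Increasing.

Lemma skip_set_flag (S : {set 'I_n}) : #|S| = r.+1 ->
  exists2 t : 'I_r.+1 -> 'I_n, (forall i j : 'I_r.+1, (i < j)%N -> (t i < t j)%N)
    & S = [set rev_ord (t i) | i : 'I_r.+1]%SET.
Proof.
move=> cardS; pose s := [seq p <- enum 'I_n | rev_ord p \in S].
have szs : size s = r.+1.
  rewrite -cardS -(card_imset _ (@rev_ord_inj n)).
  rewrite -(card_uniqP (filter_uniq _ (enum_uniq _))); apply: eq_card => x.
  rewrite mem_filter mem_enum andbT -{2}(rev_ordK x).
  by rewrite (mem_imset _ _ (@rev_ord_inj n)).
have sorted_s : sorted (fun x y : 'I_n => (x < y)%N) s.
  by apply: sorted_filter sorted_enum_ord => y x z; apply: ltn_trans.
have [x0 _] : exists x0, x0 \in S by apply/card_gt0P; rewrite cardS.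
exists (fun i : 'I_r.+1 => nth x0 s i) => [i j ij|].
  by apply: sorted_nth_incr; rewrite // ij szs ltn_ord.
apply/finset.setP => x; apply/idP/imsetP => [xS|[i _ ->]].
  have xs : rev_ord x \in s by rewrite mem_filter rev_ordK xS mem_enum.
  have lti : (index (rev_ord x) s < r.+1)%N by rewrite -szs index_mem.
  by exists (Ordinal lti); rewrite //= nth_index // rev_ordK.
have : nth x0 s i \in s by rewrite mem_nth // szs.
by rewrite mem_filter => /andP[].
Qed.

Definition gstate s p := foldl gstep k (take p s).

Lemma accept_foldl j s : accept j s = (foldl gstep j s == 0%N).
Proof. by elim: s j => //= a s IHs j. Qed.

Definition rejected (s : seq nat) p := (gstate s p <= nth 0 s p)%N.

(** Each of the first [p] letters is either rejected or lowers the state by exactly one. *)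
Lemma gstate_rejected s p : (p <= size s)%N ->
  (gstate s p + p = k + count (rejected s) (iota 0 p))%N.
Proof.
elim: p => [|p IHp] ltp; first by rewrite /gstate take0 !addn0.
have -> : gstate s p.+1 = gstep (gstate s p) (nth 0%N s p).
  by rewrite /gstate (take_nth 0%N ltp) -cats1 foldl_cat.
have -> : iota 0 p.+1 = iota 0 p ++ [:: p] by rewrite -addn1 iotaD.
rewrite count_cat /= addn0.
have := IHp (ltnW ltp); set c := count _ _; rewrite /rejected /gstep.
by case: ltnP => /=; lia.
Qed.

(* Keep the [r.+1] rightmost positions rejected by the greedy algorithm. *)
Lemma rejected_flag (m : 'X_{1..n}) : ~~ accept k m ->
  exists2 t : 'I_r.+1 -> 'I_n, (forall i j : 'I_r.+1, (i < j)%N -> (t i < t j)%N)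
    & (flag_exp t (skip_part t) <= m)%MM.
Proof.
have szm : size m = n by rewrite size_tuple.
rewrite accept_foldl -lt0n => st_gt0.
pose R := [seq p : 'I_n <- enum 'I_n | rejected m p].
have mapR : map val R = filter (rejected m) (iota 0 n).
  by rewrite -val_enum_ord filter_map.
(* The final state is positive, so [gstate_rejected] at [n] gives more than [n - k = r]
   rejections. *)
have szR : (r.+1 <= size R)%N.
  rewrite -(size_map val) mapR size_filter.
  have := @gstate_rejected m n; rewrite szm leqnn => /(_ isT).
  by move: st_gt0; rewrite /gstate take_oversize ?szm //; lia.
have sorted_R : sorted (fun x y : 'I_n => (x < y)%N) R.
  by apply: sorted_filter sorted_enum_ord => y x z; apply: ltn_trans.
have x0 : 'I_n by case: (R) szR => [|x].
pose d := (size R - r.+1)%N.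
pose t (i : 'I_r.+1) := nth x0 R (d + i).
have ltd (i : 'I_r.+1) : (d + i < size R)%N by have := ltn_ord i; rewrite /d; lia.
have t_incr (i j : 'I_r.+1) : (i < j)%N -> (t i < t j)%N.
  by move=> ij; apply: sorted_nth_incr; rewrite // ltn_add2l ij ltd.
exists t => //; apply/mnm_lepP => p.
have [/existsP[i /eqP <-]|] := boolP [exists i, t i == p]; last first.
  by rewrite negb_exists => /forallP tp; rewrite flag_exp_out.
rewrite flag_expE // /skip_part (mnm_nth 0%N).
have : t i \in R by apply: mem_nth.
rewrite mem_filter => /andP[rej_ti _]; apply: leq_trans (rej_ti).
have ltti := ltn_ord (t i).
have := @gstate_rejected m (t i); rewrite szm (ltnW ltti) => /(_ isT).
(* With [d + i] rejections before [t i], the state there is [k + d + i - t i], at least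
   [skip_part t i], and rejection bounds it by the exponent. *)
suff -> : count (rejected m) (iota 0 (t i)) = (d + i)%N by lia.
have uR : uniq (map val R) by rewrite mapR filter_uniq ?iota_uniq.
have /= <- := index_uniq (x0 : nat) (i := d + i) _ uR; last by rewrite size_map.
rewrite (nth_map x0) // -/(t i) mapR.
have -> : iota 0 n = iota 0 (t i + (n - (t i).+1).+1) by congr iota; lia.
rewrite iotaD filter_cat index_cat mem_filter mem_iota add0n ltnn andbF /=.
by rewrite rej_ti /= eqxx addn0 size_filter.
Qed.

End SkipSequences.

(** * Reduction to substaircase monomials *)

Section Reduction.
Variables (K : fieldType) (n k : nat).
Hypothesis le_kn : (k <= n)%N.
Local Notation P := {mpoly K[n]}.
Local Notation I := (Ink K n k).

Lemma Ink_mesym d : (n - k < d <= n)%N -> ideal_set I (mesym n K d).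
Proof. by move=> dk; apply: ideal_gen_sub; left; exists d. Qed.

Lemma Ink_Xk (i : 'I_n) : ideal_set I ('X_i ^+ k).
Proof. by apply: ideal_gen_sub; right; exists i. Qed.

Let r := (n - k)%N.
Let rk : (r + k = n)%N. Proof. exact: subnK. Qed.

Lemma skip_demazure_det (S : {set 'I_n}) : #|S| = (n - k + 1)%N ->
  exists2 t : 'I_r.+1 -> 'I_n, (forall i j : 'I_r.+1, (i < j)%N -> (t i < t j)%N)
    & forall p : P, demazure (rev_exponents (skip_seq S)) p ->
        p = \det (flagmx K t (skip_part k t)).
Proof.
rewrite addn1 => /(skip_set_flag (r := r))[t t_incr ->].
exists t => // p dp; apply: demazure_det (skip_seq_flag rk t_incr) dp => // [i|i j].
  by have [] := skip_partP rk t_incr i.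
exact: (skip_part_decr rk).
Qed.

Lemma demazure_gens_lead g : demazure_gens K n k g ->
  [/\ ideal_set I g, g != 0 &
    exists2 b : 'X_{1..n}, suppin (hnle^~ b) g & g@_b = 1].
Proof.
suff h : demazure_gens K n k g -> ideal_set I g /\
    exists2 b : 'X_{1..n}, suppin (hnle^~ b) g & g@_b = 1.
  move=> /h[Ig [b gb gb1]]; split=> //; last by exists b.
  by apply: contra_eq_neq gb1 => ->; rewrite mcoeff0 eq_sym oner_neq0.
move=> [[S /skip_demazure_det[t t_incr det_t] /det_t ->]|[i _ <-]].
  have mu_gt0 i : (0 < skip_part k t i)%N by have [] := skip_partP rk t_incr i.
  split; last first.
    exists (flag_exp t (skip_part k t)); first exact: suppin_det_flagmx.
    exact: mcoeff_det_flagmx.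
  apply: (det_flagmx_ideal rk) => [i|]; last exact: Ink_mesym.
  by have [] := skip_partP rk t_incr i.
split; first exact: Ink_Xk.
exists (U_(i) *+ k)%MM; rewrite mpolyXn; first exact/suppinX/hnle_refl.
by rewrite mcoeffX eqxx.
Qed.

(** Either some exponent reaches [k] and a generator ['X_i ^+ k] serves, or the greedy algorithm
    fails and [rejected_flag] yields a dividing skip monomial, which leads a Demazure character. *)
Lemma skip_lead (m : 'X_{1..n}) : ~~ nonskip k m ->
  exists g (b : 'X_{1..n}), [/\ demazure_gens K n k g, suppin (hnle^~ b) g, g@_b = 1
    & (b <= m)%MM].
Proof.
rewrite negb_and; have [ltmk /= |/allPn[a am lea] _] := boolP (all _ _).
  move=> /(rejected_flag rk)[t t_incr le_tm].
  have e := skip_seq_flag rk t_incr.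
  have [p dp] := demazure_exists K (flag_exp t (skip_part k t)).
  have mu_gt0 i : (0 < skip_part k t i)%N by have [] := skip_partP rk t_incr i.
  exists p, (flag_exp t (skip_part k t)); split=> //.
    left; exists [set rev_ord (t i) | i : 'I_r.+1]%SET; last by rewrite e.
    by rewrite (card_skip_set t_incr) addn1.
    rewrite (demazure_det t_incr mu_gt0 _ erefl dp); first exact: suppin_det_flagmx.
    exact: (skip_part_decr rk).
  rewrite (demazure_det t_incr mu_gt0 _ erefl dp); first exact: mcoeff_det_flagmx.
  exact: (skip_part_decr rk).
have /tnthP[i ea] := am.
exists ('X_i ^+ k), (U_(i) *+ k)%MM; split.
- by right; exists i.
- by rewrite mpolyXn; apply/suppinX/hnle_refl.
- by rewrite mpolyXn mcoeffX eqxx.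
apply/mnm_lepP => j; rewrite mulmnE mnm1E; have [<-|_] := eqVneq i j; last first.
  by rewrite mul0n.
by rewrite mul1n leqNgt; rewrite ea in lea.
Qed.

Lemma reduce_sum Q f (J : ideal P) : 
    (forall m, m \in msupp f -> exists s : P,
      [/\ suppin (nonskip k) s, suppin Q s & ideal_set J ('X_[m] - s)]) ->
  exists s, [/\ suppin (nonskip k) s, suppin Q s & ideal_set J (f - s)].
Proof.
rewrite {2}[f]mpolyE; elim: (msupp f) => [|m ms IHms] h.
  by exists 0; rewrite big_nil subr0; split; [exact: suppin0..|exact: ideal0].
have [|s [Gs Qs Js]] := IHms; first by move=> m' m's; apply: h; rewrite inE m's orbT.
have [s1 [Gs1 Qs1 Js1]] := h m (mem_head _ _).
exists (f@_m *: s1 + s); split; try by apply: suppinD => //; apply: suppinZ.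
rewrite big_cons opprD addrACA -scalerBr; apply: idealD => //.
exact: idealZ.
Qed.

(** Division by the generators: subtracting a multiple of [g] cancels [m] and leaves neglex-smaller
    monomials of the same degree. *)
Lemma reduce_mono (m : 'X_{1..n}) : exists s : P,
  [/\ suppin (nonskip k) s, suppin (hnle^~ m) s & ideal_set I ('X_[m] - s)].
Proof.
(* The degree bound makes the type finite, so that a cardinality can serve as the induction
   measure. *)
pose below (m : 'X_{1..n}) (d : nat) :=
  [pred x : 'X_{1..n < d.+1} | neglex n (val x) m].
have [N] := ubnP #|below m (mdeg m)|; elim: N m => // N IHN m ltN.
have [Gm|/skip_lead[g [b [/demazure_gens_lead[Ig _ _] gb gb1 le_bm]]]] :=
    boolP (nonskip k m).
  exists 'X_[m]; split; [exact/suppinX|exact/suppinX/hnle_refl|].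
  by rewrite subrr; apply: ideal0.
pose f : P := 'X_[m] - 'X_[m - b] * g.
have fm : suppin (fun x => neglex n x m && (mdeg x == mdeg m)) f.
  have : suppin (hnle^~ m) f.
    apply: suppinB; first exact/suppinX/hnle_refl.
    rewrite -(submK le_bm); apply: suppin_hnleM gb; rewrite addmK.
    exact/suppinX/hnle_refl.
  move=> fm x xf; have /andP[/predU1P[ex|->] //] := fm x xf.
  move: xf; rewrite ex mcoeff_msupp mcoeffB mcoeffX eqxx mulrC.
  by rewrite -[X in (g * _)@_X](submK le_bm) mcoeffMX gb1 /= subrr !eqxx.
have [x xf|s [Gs ms Is]] := @reduce_sum (hnle^~ m) f I.
  have /andP[lt_xm /eqP deg_x] := fm x xf.
  have [|s [Gs xs Is]] := IHN x.
    rewrite deg_x ltnS in ltN *; apply: leq_trans ltN; apply: proper_card.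
    apply/properP; split.
      by apply/fintype.subsetP => y; rewrite !inE => /neglex_trans; apply.
    have bx : (mdeg x < (mdeg m).+1)%N by rewrite deg_x.
    by exists (BMultinom bx); rewrite !inE //= neglex_irr.
  exists s; split=> //; apply: suppinW xs => y; rewrite !unfold_in.
  by move=> /hnle_trans; apply; rewrite /hnle neglexW //= deg_x.
exists s; split=> //.
have -> : 'X_[m] - s = (f - s) + 'X_[m - b] * g.
  by rewrite /f addrAC subrK.
by apply: idealD => //; apply: idealM.
Qed.

(** The instances of [Q] used below are degree bounds, strict neglex bounds and [predT]. *)
Lemma reduce_poly (Q : pred 'X_{1..n}) f :
    (forall m m', Q m -> hnle m' m -> Q m') -> suppin Q f ->
  exists s, [/\ suppin (nonskip k) s, suppin Q s & ideal_set I (f - s)].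
Proof.
move=> Qdown Qf; apply: reduce_sum => m /Qf Qm.
have [s [Gs ms Is]] := reduce_mono m; exists s; split=> // x /ms.
exact: Qdown.
Qed.

End Reduction.

(** * Leading forms and the points of Znk *)

Section LeadingForms.
Variables (K : fieldType) (n : nat).
Local Notation P := {mpoly K[n]}.
Variable J : ideal P.
Implicit Types (f g : P) (d : nat) (m : 'X_{1..n}).

Lemma mcoeff_pihomog d f m :
  (pihomog mdeg d f)@_m = if mdeg m == d then f@_m else 0.
Proof.
rewrite pihomogE raddf_sum big_mkcond /=.
have coefE x : (if mdeg x == d then (f@_x *: 'X_[x])@_m else 0)
    = if mdeg m == d then f@_x * (x == m)%:R else 0.
  rewrite mcoeffZ mcoeffX; have [->|_] := eqVneq x m => //.
  by rewrite mulr0 !if_same.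
under eq_bigr => x _ do rewrite coefE.
case: eqP => _; last by rewrite big1.
rewrite {3}[f]mpolyE raddf_sum /=; apply: eq_bigr => x _.
by rewrite mcoeffZ mcoeffX.
Qed.

(* The polynomials all of whose homogeneous components vanish or are leading
   forms of elements of [J]. *)
Definition leading_set : set P := fun f => forall d, exists g,
  [/\ ideal_set J g, suppin (fun m => mdeg m <= d)%N g
    & forall m, mdeg m = d -> g@_m = f@_m].

Lemma leading_set0 : leading_set 0.
Proof. by move=> d; exists 0; split=> //; [apply: ideal0|apply: suppin0]. Qed.

Lemma leading_setD f g : leading_set f -> leading_set g -> leading_set (f + g).
Proof.
move=> Lf Lg d; have [f' [Jf f'd ef]] := Lf d; have [g' [Jg g'd eg]] := Lg d.
exists (f' + g'); split; [exact: idealD|exact: suppinD|].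
by move=> m md; rewrite !mcoeffD ef ?eg.
Qed.

Lemma leading_setZ c f : leading_set f -> leading_set (c *: f).
Proof.
move=> Lf d; have [f' [Jf f'd ef]] := Lf d.
exists (c *: f'); split; [exact: idealZ|exact: suppinZ|].
by move=> m md; rewrite !mcoeffZ ef.
Qed.

Lemma mcoeffXM_out a f m : ~~ (a <= m)%MM -> ('X_[a] * f)@_m = 0.
Proof.
move=> nle_am; apply/eqP; rewrite mcoeff_eq0; apply: contra nle_am.
move=> /msuppM_le /allpairsP[[x y] /= [/mem_msuppXP <- _ ->]].
exact: lem_addr.
Qed.

Lemma leading_setXM a f : leading_set f -> leading_set ('X_[a] * f).
Proof.
move=> Lf d; have [le_ad|lt_da] := leqP (mdeg a) d; last first.
  exists 0; split=> [||m md]; [exact: ideal0|exact: suppin0|].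
  rewrite mcoeff0 mcoeffXM_out //; apply/negP => /submK em.
  by move: lt_da; rewrite -md -em mdegD; lia.
have [f' [Jf f'd ef]] := Lf (d - mdeg a)%N.
exists ('X_[a] * f'); split; first exact: idealM.
  apply: (suppinM (Q1 := pred1 a)) f'd => [x y /eqP -> le|]; last exact/suppinX/eqxx.
  by rewrite mdegD; lia.
move=> m md; have [/submK em|nle_am] := boolP (a <= m)%MM; last first.
  by rewrite !mcoeffXM_out.
rewrite -em addmC !(mulrC 'X_[a]) !mcoeffMX ef //.
by have := congr1 (@mdeg n) em; rewrite mdegD md => <-; rewrite addnK.
Qed.

Lemma leading_setM a f : leading_set f -> leading_set (a * f).
Proof.
move=> Lf; elim/mpolyind: a => [|c m p _ _ IHp].
  by rewrite mul0r; apply: leading_set0.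
rewrite mulrDl -scalerAl; apply: leading_setD => //.
exact/leading_setZ/leading_setXM.
Qed.

Definition leading_ideal := Ideal leading_set0 leading_setD leading_setM.

Lemma leading_homog d f g : f \is d.-homog -> ideal_set J g ->
  suppin (fun m => mdeg m < d)%N (g - f) -> leading_set f.
Proof.
move=> /dhomogP hf Jg lt_gf e; have [->|ne] := eqVneq e d; last first.
  exists 0; split=> [||m me]; [exact: ideal0|exact: suppin0|].
  rewrite mcoeff0; apply/esym/eqP; rewrite mcoeff_eq0; apply: contra ne.
  by move=> /hf hm; apply/eqP; rewrite -me; exact: hm.
exists g; split=> // [|m md].
  rewrite -(subrK f g); apply: suppinD; first by apply: suppinW lt_gf => m /ltnW.
  by move=> m /hf hm; apply: eq_leq; exact: hm.
apply/eqP; rewrite -subr_eq0 -mcoeffB mcoeff_eq0; apply/negP => /lt_gf.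
by rewrite md ltnn.
Qed.

(** An element of [J] witnesses its own top form; conversely, a nonzero component of [f] is the top
    form of the [g] given in that degree. Membership in gr J is thus tested one degree at a time. *)
Lemma gr_ideal_leading : gr_ideal J = leading_ideal.
Proof.
apply: ideal_ext; apply/seteqP; split.
  apply: ideal_gen_min => _ [f [Jf f0] <-].
  apply: (leading_homog (pihomogP _ _ _) Jf) => m.
  rewrite mcoeff_msupp mcoeffB mcoeff_pihomog.
  have [_|/eqP ne] := eqVneq (mdeg m); first by rewrite subrr eqxx.
  rewrite subr0 -mcoeff_msupp => /msize_mdeg_lt.
  by move: ne; case: (msize f) => //= d ne; rewrite ltnS leq_eqVlt => /predU1P[].
move=> f Lf; rewrite (pihomog_partitionE (leqnn (mmeasure mdeg f))).
apply: (@ideal_sum _ _ (gr_ideal J)) => d _; have [g [Jg gd eg]] := Lf d.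
have eh : pihomog mdeg d f = pihomog mdeg d g.
  by apply/mpolyP => m; rewrite !mcoeff_pihomog; case: eqP => // /eg.
have [->|nz] := eqVneq (pihomog mdeg d f) 0; first exact: ideal0.
have [m md gm] : exists2 m, mdeg m = d & m \in msupp g.
  move: nz; rewrite -msupp_eq0; case e : (msupp _) => [//|m s] _.
  have : m \in msupp (pihomog mdeg d f) by rewrite e mem_head.
  rewrite eh mcoeff_msupp mcoeff_pihomog.
  have [md|_] := eqVneq (mdeg m); last by rewrite eqxx.
  by rewrite -mcoeff_msupp; exists m.
have szg : msize g = d.+1.
  apply/eqP; rewrite eqn_leq -{2}md msize_mdeg_lt // andbT.
  by apply/msize_suppin => x /gd.
apply: ideal_gen_sub; exists g; last by rewrite /top_form szg.
by split=> //; apply/eqP => g0; rewrite g0 msupp0 in gm.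
Qed.

End LeadingForms.

Section Interpolation.
Variables (K : fieldType) (A B : finType).

(** A square matrix of full rank has trivial kernel. Here rows will be substaircase monomials and
    columns Fubini words, with evaluation or its average as entries. *)
Lemma fin_surj_inj (M : A -> B -> K) : #|A| = #|B| ->
    (forall v : B -> K, exists c : A -> K, forall b, \sum_a c a * M a b = v b) ->
  forall c : A -> K, (forall b, \sum_a c a * M a b = 0) -> forall a, c a = 0.
Proof.
move=> cardAB surj c c0 a.
pose N : 'M[K]_(#|A|, #|B|) := \matrix_(i, j) M (enum_val i) (enum_val j).
have mulN m (X : 'M_(m, #|A|)) i b :
    (X *m N) i (enum_rank b) = \sum_a X i (enum_rank a) * M a b.
  rewrite mxE (reindex (@enum_rank A)) /=; last exact/onW_bij/enum_rank_bij.
  by apply: eq_bigr => x _; rewrite mxE !enum_rankK.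
have fullN : row_full N.
  apply/row_fullP.
  have /choice[X XP] : forall j : 'I_#|B|, exists c : A -> K,
      forall b, \sum_a c a * M a b = (enum_val j == b)%:R.
    by move=> j; apply: surj.
  exists (\matrix_(j, i) X j (enum_val i)); apply/matrixP => i j.
  rewrite -{1}(enum_valK j) mulN mxE -(inj_eq enum_val_inj).
  by rewrite -[RHS]XP; apply: eq_bigr => x _; rewrite mxE enum_rankK.
have freeN : row_free N.
  by move/eqP: fullN => rankN; rewrite /row_free rankN cardAB.
pose x : 'rV[K]_#|A| := \row_i c (enum_val i).
have x0 : x *m N = 0.
  apply/rowP => j; rewrite -(enum_valK j) mulN mxE -[RHS](c0 (enum_val j)).
  by apply: eq_bigr => y _; rewrite mxE enum_rankK.
have /rowP/(_ (enum_rank a)) : x = 0.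
  by apply/eqP; rewrite -(mulmx_free_eq0 _ freeN) x0.
by rewrite !mxE enum_rankK.
Qed.

End Interpolation.

(** * Substaircase monomials as functions on the points *)

Section Points.
Variables (K : fieldType) (n k : nat) (alpha : 'I_k -> K).
Hypotheses (le_kn : (k <= n)%N) (alpha_inj : injective alpha).
Local Notation P := {mpoly K[n]}.
Local Notation I := (Ink K n k).
Local Notation J := (vanishing_ideal (Znk n alpha)).
Local Notation W := (fubini_word n k).
Implicit Types (f g s : P) (w : W) (m : 'X_{1..n}).

Definition word_point w : 'I_n -> K := fun i => alpha (val w i).

Lemma vanishingE f : ideal_set J f <-> forall w, f.@[word_point w] = 0.
Proof.
split=> [Jf w|f0 _ [w _ <-]]; last exact: f0.
by apply: Jf; exists w.
Qed.

Lemma leading_Xk (i : 'I_n) : ideal_set (leading_ideal J) ('X_i ^+ k).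
Proof.
apply: (@leading_homog _ _ _ k _ (\prod_(a : 'I_k) ('X_i - (alpha a)%:MP))).
- by rewrite mpolyXn dhomogX /= mdegMn mdeg1 mul1n.
- apply/vanishingE => w; rewrite rmorph_prod (bigD1 (val w i)) //=.
  by rewrite mevalB mevalXU mevalC subrr mul0r.
suff h (s : seq 'I_k) : suppin (fun m => mdeg m < size s)%N
    (\prod_(a <- s) ('X_i - (alpha a)%:MP) - 'X_i ^+ size s : P).
  by have := h (enum 'I_k); rewrite big_enum size_enum_ord.
elim: s => [|a s IHs] /=.
  by rewrite big_nil expr0 subrr; apply: suppin0.
rewrite big_cons exprS; set p := \prod_(_ <- _) _ in IHs *.
have -> : ('X_i - (alpha a)%:MP) * p - 'X_i * 'X_i ^+ size s
    = 'X_i * (p - 'X_i ^+ size s)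
      - alpha a *: ((p - 'X_i ^+ size s) + 'X_i ^+ size s).
  by rewrite subrK mulrBl mul_mpolyC mulrBr addrAC.
apply: suppinB.
  apply: (suppinM (Q1 := fun m => mdeg m == 1%N)) IHs => [x y /eqP ex ey|].
    by rewrite mdegD ex.
  by apply/suppinX; rewrite mdeg1.
apply: suppinZ; apply: suppinD.
  by apply: suppinW IHs => x; rewrite !unfold_in => /ltnW.
by rewrite mpolyXn; apply/suppinX; rewrite mdegMn mdeg1 mul1n.
Qed.

Lemma fubini_section w : exists2 sec : 'I_k -> 'I_n, injective sec & cancel sec (val w).
Proof.
have /choice[sec secK] : forall a, exists i, val w i = a.
  by move=> a; have /existsP[i /eqP e] := forallP (valP w) a; exists i.
by exists sec => //; apply: can_inj secK.
Qed.

(* On [Znk], \prod_(i : 'I_n) (1 - x_i Z) / \prod_a (1 - alpha_a Z) is a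
   polynomial of degree at most [n - k] in Z. *)
Lemma sum_mesym_point w d : (n - k < d)%N ->
  \sum_(l < d.+1) ((-1) ^+ l * hsym (map alpha (enum 'I_k)) (d - l))
    * (mesym n K l).@[word_point w] = 0.
Proof.
move=> lt_d; have [sec sec_inj secK] := fubini_section w.
(* Dividing by the factors of the letters removes one position per letter and leaves [n - k]
   factors. *)
pose q : {poly K} := \prod_(i | i \notin codom sec) (1 - word_point w i *: 'X).
have Eq : q * \prod_(x <- map alpha (enum 'I_k)) (1 - x *: 'X)
    = \prod_(i : 'I_n) (1 - word_point w i *: 'X).
  rewrite [RHS](bigID (mem (codom sec))) /= mulrC big_map big_enum /=.
  congr (_ * _); rewrite [RHS](reindex_onto sec (val w)) => [|i /codomP[a ->]] /=.
    apply: eq_big => [a|a _]; first by rewrite codom_f secK eqxx.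
    by rewrite /word_point secK.
  by rewrite secK.
have szq : (size q <= n - k + 1)%N.
  apply: leq_trans (size_prod_1subZX _ _) _.
  rewrite addn1 ltnS -[X in (_ <= X - _)%N]card_ord -(cardC (mem (codom sec))).
  by rewrite card_codom // card_ord addKn.
have := coef_conv_hsym (map alpha (enum 'I_k)) q d.
rewrite Eq [RHS]nth_default => [e|]; last by apply: leq_trans szq _; lia.
rewrite -[RHS]e; apply: eq_bigr => l _; rewrite mulrAC; congr (_ * _).
have -> : \prod_(i : 'I_n) (1 - word_point w i *: 'X)
    = map_poly (meval (word_point w)) (\prod_(i : 'I_n) (1 - 'X_i *: 'X)).
  rewrite rmorph_prod; apply: eq_bigr => i _.
  by rewrite rmorphB rmorph1 /= map_polyZ map_polyX /= mevalXU.
by rewrite coef_map coef_prod_vars /= mevalM rmorphXn rmorphN1.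
Qed.

Lemma leading_mesym d : (n - k < d)%N -> ideal_set (leading_ideal J) (mesym n K d).
Proof.
move=> lt_d.
have -> : mesym n K d = (-1) ^+ d *: ((-1) ^+ d *: mesym n K d).
  by rewrite scalerA -exprMn mulrNN mulr1 expr1n scale1r.
apply: (leading_setZ (J := J)).
pose h := hsym (map alpha (enum 'I_k)).
(* [g] vanishes on [Znk] by [sum_mesym_point]. Its top term is [l = d], with coefficient [(-1) ^+ d]
   since [h 0 = 1]; hence the sign split off above. *)
pose g : P := \sum_(l < d.+1) ((-1) ^+ l * h (d - l)%N) *: mesym n K l.
have mesym_homog l : mesym n K l \is l.-homog.
  by apply/dhomogP => m; rewrite mem_msupp_mesym => /andP[/eqP].
apply: (@leading_homog _ _ _ d _ g).
- by apply: dhomogZ; apply: mesym_homog.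
- apply/vanishingE => w; rewrite raddf_sum /= -[RHS](sum_mesym_point w lt_d).
  by apply: eq_bigr => l _; rewrite mevalZ.
rewrite /g big_ord_recr /= subnn /h hsym0 mulr1 addrK.
apply: suppin_sum => l _; apply: suppinZ => m.
rewrite mem_msupp_mesym => /andP[/eqP -> _].
exact: ltn_ord.
Qed.

Lemma Ink_leading f : ideal_set I f -> ideal_set (leading_ideal J) f.
Proof.
apply: ideal_gen_min => _ [[d /andP[lt_d _] <-]|[i _ <-]].
  exact: leading_mesym.
exact: leading_Xk.
Qed.

(** Reduction modulo [I] leaves a difference in [I], whose top component is matched by an element of
    [J] of no larger degree. Subtracting that element lowers the degree, and induction applies. *)
Lemma reduce_vanishing d f : suppin (fun m => mdeg m < d)%N f ->
  exists s, [/\ suppin (nonskip k) s, suppin (fun m => mdeg m < d)%N s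
    & ideal_set J (f - s)].
Proof.
elim: d f => [|d IHd] f fd.
  exists 0; split; [exact: suppin0..|].
  rewrite subr0 (_ : f = 0); first exact: ideal0.
  by apply/mpolyP => m; apply/eqP; rewrite mcoeff0 mcoeff_eq0; apply/negP => /fd.
have [|s [Gs sd Is]] := reduce_poly le_kn _ fd.
  by move=> m m' /= md /andP[_ /eqP ->].
have [g [Jg gd eg]] := Ink_leading Is d.
have [|s' [Gs' s'd Js']] := IHd (f - s - g).
  move=> m; rewrite mcoeff_msupp mcoeffB; have [lt|] := ltnP (mdeg m) d => //.
  rewrite leq_eqVlt => /orP[/eqP/esym md|lt_dm]; first by rewrite eg // subrr eqxx.
  have /suppin_coef := suppinB fd sd => /(_ m) ->; last by rewrite -leqNgt.
  have /suppin_coef := gd => /(_ m) ->; last by rewrite -ltnNge.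
  by rewrite subrr eqxx.
exists (s + s'); split; first exact: suppinD.
  by apply: suppinD => //; apply: suppinW s'd => m; rewrite !unfold_in => /ltnW; rewrite ltnS.
have -> : f - (s + s') = (f - s - g - s') + g.
  by rewrite opprD addrA (addrAC _ (- g)) subrK.
exact: idealD.
Qed.

Lemma interpolation (v : W -> K) : exists f, forall w, f.@[word_point w] = v w.
Proof.
(* Unnormalized Lagrange polynomials: at another word some coordinate differs and kills a factor. *)
pose delta w : P := \prod_(i : 'I_n) \prod_(a : 'I_k | a != val w i)
  ('X_i - (alpha a)%:MP).
have delta_neq w w' : w' != w -> (delta w).@[word_point w'] = 0.
  move=> ne; have [i nei] : exists i, val w' i != val w i.
    apply/existsP; apply: contraR ne; rewrite negb_exists => /forallP e.
    by apply/eqP/val_inj/ffunP => i; apply/eqP; have := e i; rewrite negbK.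
  rewrite rmorph_prod (bigD1 i) //= rmorph_prod (bigD1 (val w' i)) //=.
  by rewrite mevalB mevalXU mevalC subrr !mul0r.
have delta_nz w : (delta w).@[word_point w] != 0.
  rewrite rmorph_prod /=; apply/prodf_neq0 => i _.
  rewrite rmorph_prod /=; apply/prodf_neq0 => a ne.
  by rewrite mevalB mevalXU mevalC subr_eq0 (inj_eq alpha_inj) eq_sym.
exists (\sum_w (v w / (delta w).@[word_point w]) *: delta w) => w.
rewrite raddf_sum (bigD1 w) //= big1 ?addr0 => [|w' ne].
  by rewrite mevalZ divfK.
by rewrite mevalZ (delta_neq w' w) ?mulr0 // eq_sym.
Qed.

Definition acc_exp (a : accepted k n) : 'X_{1..n} := [multinom (tnth (val a) i : nat) | i < n].

Lemma acc_exp_nonskip a : nonskip k (acc_exp a).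
Proof.
have e : (acc_exp a : seq nat) = map val (val a).
  apply: (@eq_from_nth _ 0%N); rewrite size_tuple ?size_map ?size_tuple // => i lti.
  rewrite (_ : i = Ordinal lti) // -mnm_nth mnmE (nth_map (tnth (val a) (Ordinal lti))).
    by rewrite -tnth_nth.
  by rewrite size_tuple.
rewrite /nonskip e (valP a) andbT.
by apply/allP => x /mapP[c _ ->]; apply: ltn_ord.
Qed.

Lemma acc_exp_inj : injective acc_exp.
Proof.
move=> a b /mnmP e; apply/val_inj/eq_from_tnth => i; apply/val_inj.
by have := e i; rewrite !mnmE.
Qed.

Lemma acc_exp_surj m : nonskip k m -> exists a, acc_exp a = m.
Proof.
move=> /andP[/allP ltk acc].
have lt i : (m i < k)%N by apply: ltk; rewrite mem_tnth.
pose t := [tuple Ordinal (lt i) | i < n].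
have e : multinom_val m = map_tuple val t.
  by apply: eq_from_tnth => i; rewrite tnth_map tnth_mktuple.
have acct : accept k (map val t) by move: acc; rewrite e.
exists (exist _ t acct); apply/mnmP => i.
by rewrite mnmE /= tnth_mktuple.
Qed.

Lemma nonskip_sumE s : suppin (nonskip k) s ->
  s = \sum_(a : accepted k n) s@_(acc_exp a) *: 'X_[acc_exp a].
Proof.
move=> Gs; apply/mpolyP => m; rewrite raddf_sum /=.
have [/acc_exp_surj[a <-]|nGm] := boolP (nonskip k m).
  rewrite (bigD1 a) //= mcoeffZ mcoeffX eqxx mulr1 big1 ?addr0 // => b ne.
  by rewrite mcoeffZ mcoeffX (inj_eq acc_exp_inj) (negPf ne) mulr0.
have /suppin_coef -> // := Gs; rewrite big1 // => a _.
rewrite mcoeffZ mcoeffX; case: eqP => [e|]; last by rewrite mulr0.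
by rewrite -e acc_exp_nonskip in nGm.
Qed.

(** Interpolating and then reducing shows that substaircase monomials span the functions on [Znk].
    There are as many of them as points, so they are independent. *)
Lemma nonskip_vanishing0 s : suppin (nonskip k) s -> ideal_set J s -> s = 0.
Proof.
move=> Gs /vanishingE Js.
pose M (a : accepted k n) w := ('X_[acc_exp a] : P).@[word_point w].
have evalE (s' : P) w : suppin (nonskip k) s' ->
    \sum_a s'@_(acc_exp a) * M a w = s'.@[word_point w].
  move=> Gs'; rewrite [in RHS](nonskip_sumE Gs') raddf_sum /=.
  by apply: eq_bigr => a _; rewrite mevalZ.
have c0 : forall a, s@_(acc_exp a) = 0.
  apply: (@fin_surj_inj _ _ _ M); first exact: card_accepted.
    move=> v; have [f fv] := interpolation v.
    have fd : suppin (fun m => mdeg m < msize f)%N f by apply/msize_suppin.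
    have [s' [Gs' _ /vanishingE Js']] := reduce_vanishing fd.
    exists (fun a => s'@_(acc_exp a)) => w; rewrite evalE // -fv.
    by apply/esym/eqP; rewrite -subr_eq0 -mevalB Js'.
  by move=> w; rewrite evalE.
rewrite (nonskip_sumE Gs) big1 // => a _.
by rewrite c0 scale0r.
Qed.

(** Some [g] in [J] leads with the degree [d] component of [s]. Reducing its lower terms modulo [J]
    keeps them below degree [d] and gives a substaircase combination in [J], which is zero by
    [nonskip_vanishing0]; so the component is zero. *)
Lemma nonskip_leading0 s : suppin (nonskip k) s -> ideal_set (leading_ideal J) s -> s = 0.
Proof.
move=> Gs Ls; apply/mpolyP => m; rewrite mcoeff0.
set d := mdeg m; have [g [Jg gd eg]] := Ls d.
have qd : suppin (fun m => mdeg m < d)%N (g - pihomog mdeg d s).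
  move=> x; rewrite mcoeff_msupp mcoeffB mcoeff_pihomog.
  have [xd|ne] := eqVneq (mdeg x) d; first by rewrite eg // subrr eqxx.
  by rewrite subr0 -mcoeff_msupp => /gd; rewrite leq_eqVlt (negPf ne).
have [s' [Gs' s'd Js']] := reduce_vanishing qd.
have q0 : pihomog mdeg d s + s' = 0.
  apply: nonskip_vanishing0.
    apply: suppinD => // x; rewrite mcoeff_msupp mcoeff_pihomog.
    by have [_|_] := eqVneq (mdeg x) d; rewrite ?eqxx // -mcoeff_msupp => /Gs.
  have -> : pihomog mdeg d s + s' = g - (g - pihomog mdeg d s - s').
    by rewrite -(addrA g) -opprD subKr.
  exact: idealB.
have := congr1 (mcoeff m) q0; rewrite mcoeffD mcoeff_pihomog eqxx mcoeff0.
by have /suppin_coef := s'd => /(_ m) ->; rewrite ?addr0 // /d ltnn.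
Qed.

Lemma nonskip_Ink0 s : suppin (nonskip k) s -> ideal_set I s -> s = 0.
Proof. by move=> Gs /Ink_leading; apply: nonskip_leading0. Qed.

(** For [f] in gr J, the remainder modulo [I] is again in gr J, hence zero by [nonskip_leading0]. *)
Lemma gr_vanishing_Ink : gr_ideal J = I.
Proof.
rewrite gr_ideal_leading; apply: ideal_ext; apply/seteqP; split=> [f Lf|f]; last first.
  exact: Ink_leading.
have fT : suppin predT f by [].
have [//|s [Gs _ Is]] := reduce_poly le_kn _ fT.
have s0 : s = 0.
  apply: nonskip_leading0 => //; rewrite -(subKr f s).
  by apply: (@idealB _ _ (leading_ideal J)) => //; apply: Ink_leading.
by move: Is; rewrite s0 subr0.
Qed.

End Points.

(** * Initial ideal and module structure *)

Section InitialIdeal.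
Variables (K : fieldType) (n k : nat) (alpha : 'I_k -> K).
Hypotheses (k_gt0 : (0 < k)%N) (le_kn : (k <= n)%N) (alpha_inj : injective alpha).
Local Notation P := {mpoly K[n]}.
Local Notation I := (Ink K n k).
Implicit Types (f g s : P) (m b : 'X_{1..n}).

(** Some summand has a nonzero coefficient at [m], so its monomial generator divides [m]. *)
Lemma monomial_initial_ideal lt (F : set P) m :
    ideal_set (ideal_gen (initial_terms lt F)) 'X_[m] ->
  exists f b, [/\ F f, f != 0, is_initial lt f b & (b <= m)%MM].
Proof.
move=> [us usF e].
have [u [/usF [f [b [Ff f0 fb ->]]] /eqP um]] : exists u, u \in us /\ (u.1 * u.2)@_m <> 0.
  apply/not_existsP => u0; have /eqP := congr1 (mcoeff m) e.
  rewrite mcoeffX eqxx raddf_sum big_seq big1 /= ?oner_eq0 // => u us_u.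
  by have [//|/eqP nz] := eqVneq ((u.1 * u.2)@_m) 0; case: (u0 u).
exists f, b; split=> //; apply: contraNT um => nle.
by apply/eqP; rewrite mulrC; apply: mcoeffXM_out.
Qed.

Lemma suppin_initial g b : suppin (hnle^~ b) g -> g@_b = 1 -> is_initial (neglex n) g b.
Proof.
move=> gb gb1; split; first by rewrite mcoeff_msupp gb1 oner_neq0.
by move=> m /gb /andP[/predU1P[->|//] _]; rewrite eqxx.
Qed.

(** Otherwise a multiple of [f] has leading monomial [m]. Reducing its other terms, all
    neglex-smaller, leaves a substaircase combination in [I] whose coefficient at [m] is nonzero,
    against [nonskip_Ink0]. *)
Lemma initial_Ink_skip f b m :
  ideal_set I f -> is_initial (neglex n) f b -> (b <= m)%MM -> ~~ nonskip k m.
Proof.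
move=> If [bf lt_b] /submK em; apply/negP => Gm.
pose c := f@_b; pose h := 'X_[m - b] * f - c *: 'X_[m].
have fm : ('X_[m - b] * f)@_m = c.
  by rewrite mulrC -[X in (f * _)@_X]em mcoeffMX.
have hm : suppin (fun x => neglex n x m) h.
  have nf : suppin (nle^~ m) ('X_[m - b] * f).
    apply: (suppinM (Q1 := pred1 (m - b)%MM) (Q2 := nle^~ b)) => [x y /eqP ->||].
    - by rewrite -{2}em => /(nleD (nle_refl (m - b)%MM)).
    - exact/suppinX/eqxx.
    - by move=> x xf; rewrite /nle; have [//|/(lt_b x xf)] := eqVneq x b.
  move=> x; rewrite mcoeff_msupp mcoeffB mcoeffZ mcoeffX.
  have [<-|ne] := eqVneq m x; first by rewrite fm mulr1 subrr eqxx.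
  rewrite mulr0 subr0 -mcoeff_msupp => /nf; rewrite /nle eq_sym (negPf ne).
  by [].
have [|s [Gs ms Is]] := reduce_poly le_kn _ hm.
  by move=> x y xm /andP[/predU1P[-> //|lt] _]; apply: neglex_trans lt xm.
have /(congr1 (mcoeff m)) : c *: 'X_[m] + s = 0.
  apply: (nonskip_Ink0 le_kn alpha_inj).
    by apply: suppinD => //; apply/suppinZ/suppinX.
  have -> : c *: 'X_[m] + s = 'X_[m - b] * f - (h - s).
    by rewrite /h -(addrA ('X_[_] * f)) -opprD subKr.
  by apply: idealB => //; apply: idealM.
rewrite mcoeffD mcoeffZ mcoeffX eqxx mulr1 mcoeff0.
have /suppin_coef := ms => /(_ m) ->; rewrite ?neglex_irr // addr0 => /eqP.
by rewrite /c mcoeff_eq0 bf.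
Qed.

Lemma skip_initial m : ~~ nonskip k m ->
  ideal_set (ideal_gen (initial_terms (neglex n) (demazure_gens K n k))) 'X_[m].
Proof.
move=> /(skip_lead K le_kn)[g [b [Gg gb gb1 /submK <-]]].
rewrite mpolyXD; apply/idealM/ideal_gen_sub; exists g, b; split=> //.
  by have [] := demazure_gens_lead le_kn Gg.
exact: suppin_initial.
Qed.

Lemma demazure_gens_Ink g : demazure_gens K n k g -> ideal_set I g.
Proof. by move=> /(demazure_gens_lead le_kn)[]. Qed.

Lemma demazure_initial_ideal : initial_ideal (neglex n) I
  = ideal_gen (initial_terms (neglex n) (demazure_gens K n k)).
Proof.
apply: ideal_ext; apply/seteqP; split; apply: ideal_gen_min => _ [f [b [Ff f0 fb ->]]].
  exact: skip_initial (initial_Ink_skip Ff fb (lepm_refl b)).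
apply: ideal_gen_sub; exists f, b; split=> //; exact: demazure_gens_Ink.
Qed.

Lemma demazure_gens_finite : finite_set (demazure_gens K n k).
Proof.
rewrite /demazure_gens finite_setU; split; last first.
  by apply: finite_image; apply: finite_finset.
have /choice[D DP] : forall S : {set 'I_n}, exists p : P,
    demazure (rev_exponents (skip_seq S)) p by move=> S; apply: demazure_exists.
apply: (@sub_finite_set _ _ [set D S | S in [set: {set 'I_n}]]%classic); last first.
  by apply: finite_image; apply: finite_finset.
(* All values for [S] are one and the same determinant, hence equal to the chosen [D S]. *)
move=> p [S /(skip_demazure_det K le_kn)[t _ det_t] /det_t ->].
by exists S => //; apply: det_t.
Qed.

Lemma demazure_groebner : groebner_basis (neglex n) I (demazure_gens K n k).
Proof.
split; [exact: demazure_gens_finite|exact: demazure_gens_Ink| |].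
  by move=> g /(demazure_gens_lead le_kn)[].
exact: demazure_initial_ideal.
Qed.

Lemma standard_monomials_Ank : standard_monomials (neglex n) I = Ank K n k.
Proof.
apply/seteqP; split=> [_ [m -> nm]|_ [m /(substaircaseE k_gt0 le_kn) Gm <-]].
  exists m => //; apply/(substaircaseE k_gt0 le_kn)/negPn/negP => /skip_initial.
  by rewrite -demazure_initial_ideal.
exists m => // /monomial_initial_ideal[f [b [If _ fb le_bm]]].
by have := initial_Ink_skip If fb le_bm; rewrite Gm.
Qed.

End InitialIdeal.

(** * The isomorphism with the permutation module *)

Section Equivariance.
Variables (K : fieldType) (n k : nat) (alpha : 'I_k -> K).
Hypotheses (le_kn : (k <= n)%N) (alpha_inj : injective alpha).
Hypothesis fact_neq0 : (n`!)%:R != 0 :> K.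
Local Notation P := {mpoly K[n]}.
Local Notation I := (Ink K n k).
Local Notation J := (vanishing_ideal (Znk n alpha)).
Local Notation W := (fubini_word n k).
Implicit Types (f g s : P) (w : W) (m : 'X_{1..n}) (u v : 'S_n).

Lemma fubini_actM u v w : fubini_act (u * v)%g w = fubini_act v (fubini_act u w).
Proof. by apply/val_inj/ffunP => i; rewrite !ffunE invMg permM. Qed.

Lemma fubini_actKV v : cancel (fubini_act v) (fubini_act (n := n) (k := k) v^-1%g).
Proof.
by move=> w; apply/val_inj/ffunP => i; rewrite !ffunE invgK permK.
Qed.

Lemma meval_msym v f (z : 'I_n -> K) : (msym v f).@[z] = f.@[z \o v].
Proof.
elim/mpolyind: f => [|c m p _ _ IHp]; first by rewrite msym0 !meval0.
rewrite msymD msymZ !mevalD !mevalZ IHp msymX !mevalX; congr (_ * _ + _).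
by rewrite [LHS](reindex_inj (@perm_inj _ v)); apply: eq_bigr => i _; rewrite mnmE permK.
Qed.

Lemma meval_msym_point v f w :
  (msym v f).@[word_point alpha (fubini_act v w)] = f.@[word_point alpha w].
Proof.
rewrite meval_msym; apply: meval_eq => i.
by rewrite /= /word_point ffunE permK.
Qed.

Lemma suppin_msym v f d :
  suppin (fun m => mdeg m < d)%N f -> suppin (fun m => mdeg m < d)%N (msym v f).
Proof.
move=> fd m; rewrite mcoeff_msupp mcoeff_sym -mcoeff_msupp => /fd.
by rewrite mdeg_mperm.
Qed.

Lemma reduction_exists f : exists s, [/\ suppin (nonskip k) s,
  (forall d, suppin (fun m => mdeg m < d)%N f -> suppin (fun m => mdeg m < d)%N s)
  & ideal_set I (f - s)].
Proof.
have [|f' [Gf' fd' If']] := reduce_poly le_kn _ (proj1 (msize_suppin _ _) (leqnn (msize f))).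
  by move=> x y /= lt /andP[_ /eqP ->].
exists f'; split=> // d /msize_suppin le_d.
by apply: suppinW fd' => x; rewrite !unfold_in /= => lt; apply: leq_trans lt le_d.
Qed.

Definition reduction f := projT1 (cid (reduction_exists f)).

Lemma reductionP f : [/\ suppin (nonskip k) (reduction f),
  (forall d, suppin (fun m => mdeg m < d)%N f ->
     suppin (fun m => mdeg m < d)%N (reduction f))
  & ideal_set I (f - reduction f)].
Proof. exact: projT2 (cid (reduction_exists f)). Qed.

(** Uniqueness of remainders, by [nonskip_Ink0]; it makes the map chosen through [cid] linear. *)
Lemma reduction_eq f s :
  suppin (nonskip k) s -> ideal_set I (f - s) -> reduction f = s.
Proof.
move=> Gs Is; have [Gr _ Ir] := reductionP f.
apply/eqP; rewrite -subr_eq0; apply/eqP.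
apply: (nonskip_Ink0 le_kn alpha_inj); first exact: suppinB.
have -> : reduction f - s = (f - s) - (f - reduction f).
  by rewrite opprB [RHS]addrC addrA subrK.
exact: idealB.
Qed.

Lemma reduction_linear c f g :
  reduction (c *: f + g) = c *: reduction f + reduction g.
Proof.
have [Gf _ If] := reductionP f; have [Gg _ Ig] := reductionP g.
apply: reduction_eq; first by apply: suppinD => //; apply: suppinZ.
by rewrite opprD addrACA -scalerBr; apply: idealD => //; apply: idealZ.
Qed.

Lemma reduction_Ink f : ideal_set I f -> reduction f = 0.
Proof. by move=> If; apply: reduction_eq; [exact: suppin0|rewrite subr0]. Qed.

(* Evaluation of the reduction on [Znk], averaged (up to the factor n!) over
   the symmetric group. *)
Definition averaged f : CWnk K n k :=
  [ffun w => \sum_(v : 'S_n) (reduction (msym v f)).@[word_point alpha (fubini_act v w)]].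

Lemma averaged_linear : linear averaged.
Proof.
move=> c f g; apply/ffunP => w; rewrite !ffunE scaler_sumr -big_split /=; apply: eq_bigr => v _.
by rewrite msymD msymZ reduction_linear mevalD mevalZ.
Qed.

HB.instance Definition _ :=
  GRing.isLinear.Build K P (CWnk K n k) _ averaged averaged_linear.

Lemma averaged_Ink f : ideal_set I f -> averaged f = 0.
Proof.
move=> If; apply/ffunP => w; rewrite !ffunE big1 // => v _.
by rewrite reduction_Ink ?meval0 //; apply: Ink_msym.
Qed.

(** Reduction alone need not commute with permutations; reindexing the sum over the group gives
    equivariance. *)
Lemma averaged_msym u f : averaged (msym u f) = CWnk_act K n k u (averaged f).
Proof.
apply/ffunP => w; rewrite !ffunE (reindex_inj (mulgI u^-1%g)) /=.
by apply: eq_bigr => v _; rewrite -msymMm mulKVg fubini_actM.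
Qed.

(** [averaged f] is [n!] times the evaluation of [f] plus the evaluation of a polynomial of smaller
    degree; induction on the degree reaches every evaluation, and interpolation every function. *)
Lemma averaged_surj (F : CWnk K n k) : exists f, averaged f = F.
Proof.
suff surj d f : suppin (fun m => mdeg m < d)%N f ->
    exists g, forall w, averaged g w = f.@[word_point alpha w].
  have [f fF] := interpolation alpha_inj F.
  have [g gf] := surj _ f (proj1 (msize_suppin _ _) (leqnn (msize f))).
  by exists g; apply/ffunP => w; rewrite gf fF.
elim: d f => [|d IHd] f fd.
  exists 0 => w; rewrite averaged_Ink; last exact: ideal0.
  rewrite ffunE (_ : f = 0) ?meval0 //.
  by apply/mpolyP => m; apply/eqP; rewrite mcoeff0 mcoeff_eq0; apply/negP => /fd.
(* The correction made by the reduction lies in [I]; subtracting an element of [J] with the same top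
   component lowers its degree and keeps its values on [Znk]. *)
have /choice[h hP] v : exists h, suppin (fun m => mdeg m < d)%N h /\
    forall w, h.@[word_point alpha w] = (reduction (msym v f) - msym v f).@[word_point alpha w].
  have [_ rd Ir] := reductionP (msym v f).
  have {}rd := rd _ (suppin_msym (v := v) fd).
  have : ideal_set I (reduction (msym v f) - msym v f) by rewrite -opprB; apply: idealN.
  move=> /(Ink_leading alpha le_kn)/(_ d)[g [Jg gd eg]].
  exists (reduction (msym v f) - msym v f - g); split.
    move=> m; rewrite mcoeff_msupp mcoeffB; have [//|] := ltnP (mdeg m) d.
    rewrite leq_eqVlt => /orP[/eqP/esym md|lt_dm]; first by rewrite eg // subrr eqxx.
    have /suppin_coef := suppinB rd (suppin_msym (v := v) fd) => /(_ m) ->; last by rewrite -leqNgt.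
    have /suppin_coef := gd => /(_ m) ->; last by rewrite -ltnNge.
    by rewrite subrr eqxx.
  by move=> w; rewrite mevalB (proj1 (vanishingE _ _) Jg) subr0.
(* Transported back to the point of [w], the corrections add up to one polynomial of lower
   degree. *)
have [|g' g'E] := IHd (\sum_v msym v^-1%g (h v)).
  by apply: suppin_sum => v _; apply: suppin_msym; have [] := hP v.
exists ((n`!)%:R^-1 *: (f - g')) => w.
rewrite linearZ linearB /=.
have -> : ((n`!)%:R^-1 *: (averaged f - averaged g') : CWnk K n k) w
    = (n`!)%:R^-1 * (averaged f w - averaged g' w) by rewrite !ffunE.
rewrite g'E ffunE (raddf_sum (meval (word_point alpha w))) /= -sumrB.
transitivity ((n`!)%:R^-1 * \sum_(v : 'S_n) f.@[word_point alpha w]); last first.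
  by rewrite sumr_const card_Sn -[X in _ * X]mulr_natl mulKf.
congr (_ * _); apply: eq_bigr => v _.
rewrite -{2}(fubini_actKV v w) meval_msym_point (proj2 (hP v)) mevalB.
by rewrite meval_msym_point opprB addrCA subrr addr0.
Qed.

Definition averaged_quo (x : Rnk K n k) : CWnk K n k := averaged (repr x).

Lemma averaged_quo_pi f : averaged_quo (quo_pi I f) = averaged f.
Proof.
apply/eqP; rewrite -subr_eq0 -raddfB; apply/eqP/averaged_Ink.
by apply/quo_piP; rewrite quo_piK.
Qed.

Lemma averaged_quo_linear : linear averaged_quo.
Proof.
move=> c x y; rewrite -[x]quo_piK -[y]quo_piK -quo_piZ -raddfD !averaged_quo_pi.
exact: averaged_linear.
Qed.

HB.instance Definition _ := GRing.isLinear.Build K (Rnk K n k) (CWnk K n k) _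
  averaged_quo averaged_quo_linear.

(** By surjectivity and [card_accepted], the averages of substaircase monomials are independent, so
    the reduction of [f] is zero. *)
Lemma averaged_inj f : averaged f = 0 -> ideal_set I f.
Proof.
move=> f0; have [Gr _ Ir] := reductionP f.
suff r0 : reduction f = 0 by rewrite r0 subr0 in Ir.
have sumE s w : suppin (nonskip k) s ->
    \sum_(a : accepted k n) s@_(acc_exp a) * averaged 'X_[acc_exp a] w = averaged s w.
  move=> Gs; rewrite [in RHS](nonskip_sumE Gs) raddf_sum /= sum_ffunE.
  by apply: eq_bigr => a _; rewrite linearZ /= [RHS]ffunE.
have averaged_red h : averaged (reduction h) = averaged h.
  have [_ _ Ih] := reductionP h.
  by apply/esym/eqP; rewrite -subr_eq0 -raddfB; apply/eqP/averaged_Ink.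
rewrite (nonskip_sumE Gr) big1 // => a _.
rewrite (_ : _@_ _ = 0) ?scale0r //; move: a.
apply: (@fin_surj_inj _ _ _ (fun a w => averaged 'X_[acc_exp a] w)).
- exact: card_accepted.
- move=> v; have [g gE] := averaged_surj [ffun w => v w].
  exists (fun a => (reduction g)@_(acc_exp a)) => w.
  by have [Gg _ _] := reductionP g; rewrite sumE // averaged_red gE ffunE.
by move=> w; rewrite sumE // averaged_red f0 ffunE.
Qed.

Lemma Rnk_CWnk_isomorphic : Sn_isomorphic (Rnk_act K n k) (CWnk_act K n k).
Proof.
exists averaged_quo; split; last first.
  by move=> v x; rewrite /= -[x]quo_piK Rnk_act_pi !averaged_quo_pi averaged_msym.
have /choice[g gK] F : exists x, averaged_quo x = F.
  by have [f <-] := averaged_surj F; exists (quo_pi I f); rewrite averaged_quo_pi.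
exists g => // x; apply/eqP; rewrite -subr_eq0; apply/eqP.
rewrite -[LHS]quo_piK -[RHS](raddf0 (quo_pi I)); apply/quo_piP; rewrite subr0.
apply: averaged_inj; rewrite -averaged_quo_pi quo_piK.
by rewrite raddfB /= gK subrr.
Qed.

End Equivariance.

Local Open Scope classical_set_scope.
Local Open Scope complex_scope.

Theorem theorem2p11 (R : realType) (n k : nat) (k_gt0 : (0 < k)%N)
    (le_kn : (k <= n)%N) (alpha : 'I_k -> R[i]) (alpha_inj : injective alpha) :
  [/\ gr_ideal (vanishing_ideal (Znk n alpha)) = Ink R[i] n k,
      (Rnk R[i] n k : comPzRingType)
        = ideal_quo (gr_ideal (vanishing_ideal (Znk n alpha))),
      Sn_isomorphic (Rnk_act R[i] n k) (CWnk_act R[i] n k),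
      groebner_basis (neglex n) (Ink R[i] n k) (demazure_gens R[i] n k)
    & standard_monomials (neglex n) (Ink R[i] n k) = Ank R[i] n k].
Proof.
have gr_eq := gr_vanishing_Ink le_kn alpha_inj.
split; [exact: gr_eq|by rewrite gr_eq| | |].
- apply: (Rnk_CWnk_isomorphic le_kn alpha_inj).
  by rewrite Num.Theory.pnatr_eq0 -lt0n fact_gt0.
- exact: (demazure_groebner le_kn alpha_inj).
- exact: (standard_monomials_Ank k_gt0 le_kn alpha_inj).
Qed.
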